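(* Let $\mathfrak{C}\in\{c,B\}$. Then $\{(2^\omega,\mathbb{G}_0),(2^\omega,\mathbb{G}_1),(2^\omega,\mathbb{G}_1^{-1})\}$ is a $\preceq^{inj}_{\mathfrak{C}}$-antichain (its members are pairwise $\preceq^{inj}_{\mathfrak{C}}$-incomparable), and each of $\mathbb{G}_0,\mathbb{G}_1,\mathbb{G}_1^{-1}$ is $\preceq^{inj}_{\mathfrak{C}}$-minimal among analytic digraphs on Polish spaces of uncountable Borel chromatic number.
   Context: A digraph on a set $X$ is a relation $A\subseteq X^2$ disjoint from the diagonal $\Delta(X)=\{(x,x)\}$; $A^{-1}=\{(x,y):(y,x)\in A\}$. For relations $A$ on $X$, $B$ on $Y$ (Polish spaces), $(X,A)\preceq^{inj}_c(Y,B)$ (resp. $\preceq^{inj}_B$) means there is an injective continuous (resp. Borel) $h:X\to Y$ with $A\subseteq (h\times h)^{-1}(B)$. The Borel chromatic number of a digraph $A$ on a Polish space $X$ is the least cardinality of a Polish space $Y$ admitting a Borel map $c:X\to Y$ with $c(x)\ne c(x')$ whenever $(x,x')\in A$; it is countable iff there is a Borel such $c:X\to\omega$. A digraph $A$ in a class is $\preceq$-minimal in that class if for every $B$ in the class with $B\preceq A$ we have $A\preceq B$. Let $\psi:\omega\to 2^{<\omega}$ be the bijection enumerating finite binary sequences by length and then lexicographically ($\psi(0)=\emptyset,\psi(1)=0,\psi(2)=1,\psi(3)=00,\psi(4)=01,\dots$). Put $s_n:=\psi(n)0^{n-|\psi(n)|}$ and $\mathbb{G}_0:=\{(s_n0\gamma,s_n1\gamma):n\in\omega,\gamma\in2^\omega\}$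 (concatenation). For $s\in2^{<\omega}$, $N_s=\{\alpha\in2^\omega: s\subseteq\alpha\}$. Let $q_0=0$, $q_{n+1}=3\cdot 2^{q_n}$, $t_n:=\psi(n)0^{2^{q_n}-|\psi(n)|}$, $S_n:=\{2^{q_n}j:j\ge1\}$, $\theta_n(k)=k$ if $k\notin S_n$ and $\theta_n(2^{q_n}j)=2^{q_n}(2j+1)$ for $j\ge 1$. Define $g_n:N_{t_n0}\to N_{t_n1}$ by $g_n(\alpha)(k)=1$ if $k=2^{q_n}$ and $g_n(\alpha)(k)=\alpha(\theta_n(k))$ otherwise, and $\mathbb{G}_1:=\bigcup_n \mathrm{Graph}(g_n)$. *)

(* Defs.v *)
From Stdlib Require Import Reals Arith List.
Import ListNotations.
Open Scope R_scope.

Record TopSp := { pt : Type ; opn : (pt -> Prop) -> Prop }.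

Record Polish := {
  P_carrier :> Type ;
  P_dist : P_carrier -> P_carrier -> R ;
  P_dist_nonneg : forall x y, 0 <= P_dist x y ;
  P_dist_eq0 : forall x y, P_dist x y = 0 <-> x = y ;
  P_dist_sym : forall x y, P_dist x y = P_dist y x ;
  P_dist_tri : forall x y z, P_dist x z <= P_dist x y + P_dist y z ;
  P_complete : forall u : nat -> P_carrier,
      (forall eps, 0 < eps -> exists N, forall m n, (N <= m)%nat -> (N <= n)%nat ->
          P_dist (u m) (u n) < eps) ->
      exists l, forall eps, 0 < eps -> exists N, forall n, (N <= n)%nat ->
          P_dist (u n) l < eps ;
  P_separable : exists s : nat -> option P_carrier,
      forall x eps, 0 < eps -> exists n y, s n = Some y /\ P_dist x y < eps
}.

Definition metric_open (X : Polish) (U : X -> Prop) : Prop :=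
  forall x, U x -> exists eps, 0 < eps /\ forall y, P_dist X x y < eps -> U y.

Definition PolishT (X : Polish) : TopSp := {| pt := X ; opn := metric_open X |}.
Coercion PolishT : Polish >-> TopSp.

Definition prod_open (X Y : TopSp) (U : pt X * pt Y -> Prop) : Prop :=
  forall p, U p -> exists V W, opn X V /\ opn Y W /\ V (fst p) /\ W (snd p) /\
     (forall a b, V a -> W b -> U (a, b)).
Definition prodT (X Y : TopSp) : TopSp :=
  {| pt := pt X * pt Y ; opn := prod_open X Y |}.

Definition cantor_open (U : (nat -> bool) -> Prop) : Prop :=
  forall a, U a -> exists n, forall b, (forall k, (k < n)%nat -> b k = a k) -> U b.
Definition Cantor : TopSp := {| pt := nat -> bool ; opn := cantor_open |}.

Definition baire_open (U : (nat -> nat) -> Prop) : Prop :=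
  forall a, U a -> exists n, forall b, (forall k, (k < n)%nat -> b k = a k) -> U b.
Definition Baire : TopSp := {| pt := nat -> nat ; opn := baire_open |}.

Definition NatT : TopSp := {| pt := nat ; opn := fun _ => True |}.

Inductive borel (X : TopSp) : (pt X -> Prop) -> Prop :=
| borel_open : forall U, opn X U -> borel X U
| borel_compl : forall U, borel X U -> borel X (fun x => ~ U x)
| borel_cunion : forall F : nat -> pt X -> Prop,
    (forall n, borel X (F n)) -> borel X (fun x => exists n, F n x).

Definition continuous (X Y : TopSp) (f : pt X -> pt Y) : Prop :=
  forall V, opn Y V -> opn X (fun x => V (f x)).
Definition borel_fun (X Y : TopSp) (f : pt X -> pt Y) : Prop :=
  forall V, opn Y V -> borel X (fun x => V (f x)).

Definition analytic (X : TopSp) (S : pt X -> Prop) : Prop :=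
  (forall x, ~ S x) \/
  exists f : pt Baire -> pt X, continuous Baire X f /\
    forall x, S x <-> exists a, f a = x.

Definition injective {A B} (f : A -> B) := forall x y, f x = f y -> x = y.

Definition digraph {T} (A : T -> T -> Prop) := forall x, ~ A x x.
Definition analytic_rel (X : TopSp) (A : pt X -> pt X -> Prop) : Prop :=
  analytic (prodT X X) (fun p => A (fst p) (snd p)).
Definition inv_rel {T} (A : T -> T -> Prop) : T -> T -> Prop := fun x y => A y x.

Definition countable_borel_chromatic (X : TopSp) (A : pt X -> pt X -> Prop) : Prop :=
  exists c : pt X -> nat, borel_fun X NatT c /\
    forall x x', A x x' -> c x <> c x'.

Inductive redclass := RC | RB.
Definition good_map (C : redclass) (X Y : TopSp) (h : pt X -> pt Y) : Prop :=
  match C with RC => continuous X Y h | RB => borel_fun X Y h end.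

Definition red_le (C : redclass) (X : TopSp) (A : pt X -> pt X -> Prop)
    (Y : TopSp) (B : pt Y -> pt Y -> Prop) : Prop :=
  exists h : pt X -> pt Y, injective h /\ good_map C X Y h /\
    forall x x', A x x' -> B (h x) (h x').

Definition minimal_uncountable (C : redclass) (X : TopSp)
    (A : pt X -> pt X -> Prop) : Prop :=
  digraph A /\ analytic_rel X A /\ ~ countable_borel_chromatic X A /\
  forall (Y : Polish) (B : Y -> Y -> Prop),
    digraph B -> analytic_rel Y B -> ~ countable_borel_chromatic Y B ->
    red_le C Y B X A -> red_le C X A Y B.

Close Scope R_scope.
Open Scope nat_scope.

(** psi n : n-th finite binary sequence, by length then lexicographically.
    It is the binary expansion of n+1 with its leading 1 removed. *)
Definition psi (n : nat) : list bool :=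
  let L := Nat.log2 (S n) in
  map (fun i => Nat.testbit (S n) (L - 1 - i)) (seq 0 L).

Definition prepend (l : list bool) (g : nat -> bool) : nat -> bool :=
  fun k => if Nat.ltb k (length l) then nth k l false else g (k - length l).

Definition extends (s : list bool) (a : nat -> bool) : Prop :=
  forall k, (k < length s)%nat -> a k = nth k s false.

Definition s_seq (n : nat) : list bool := psi n ++ repeat false (n - length (psi n)).

Definition G0 (a b : nat -> bool) : Prop :=
  exists n (g : nat -> bool),
    (forall k, a k = prepend (s_seq n ++ [false]) g k) /\
    (forall k, b k = prepend (s_seq n ++ [true]) g k).

Fixpoint q (n : nat) : nat :=
  match n with O => O | S m => 3 * 2 ^ q m end%nat.

Definition t_seq (n : nat) : list bool :=
  psi n ++ repeat false (2 ^ q n - length (psi n)).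

Definition theta (n k : nat) : nat :=
  let p := (2 ^ q n)%nat in
  if (Nat.eqb (k mod p) 0 && Nat.ltb 0 k)%bool then (p * (2 * (k / p) + 1))%nat else k.

Definition g_map (n : nat) (a : nat -> bool) : nat -> bool :=
  fun k => if Nat.eqb k (2 ^ q n) then true else a (theta n k).

(** G1 = union of the graphs of g_n : N_{t_n 0} -> N_{t_n 1} *)
Definition G1 (a b : nat -> bool) : Prop :=
  exists n, extends (t_seq n ++ [false]) a /\ forall k, b k = g_map n a k.

(* Main.v *)
(** Minimality implies the antichain statement. Every point has countably many out-neighbours in
    [G0] and [G1] and countably many in-neighbours in [G0], but some points have uncountably many
    in-neighbours in [G1]; this rules out injective homomorphisms from [G1] to [G0], to the inverse
    of [G0] and to the inverse of [G1]. A reduction of [G0] to [G1] would give one in the opposite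
    direction by minimality of [G1], hence is impossible too.

    For minimality, let [h] reduce an analytic digraph [B] of uncountable Borel chromatic number to
    [G0] or [G1]. As in the proof of the G0-dichotomy, one builds ever larger finite systems of
    [B]-edges by doubling: two copies of a configuration, joined by a new edge at one vertex. Call a
    set of configurations small if some countable union of Borel [B]-independent sets meets them all.
    Analytic [B]-independent sets have Borel [B]-independent hulls by Lusin separation, so doubling
    preserves largeness, and shrinking diameters produces a limit map. Below [G0] the copies are
    disjoint, since flips are injective.

    Below [G1] the copies overlap: since [g_m] after [g_n] is [g_m] for [m < n], when the new edge is
    labelled by a larger index than all the others, the two copies of every vertex reachable from the
    joined one coincide, while those of the vertices leading to it differ. The same absorption
    identity orders the out-neighbours of a point of [2^w] linearly, and thereby lets one recode
    [2^w] by bits so that [G1] is the limit of exactly such a sequence of doublings. *)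
From Stdlib Require Import Reals Lra Lia Arith List Classical ClassicalEpsilon.
From Stdlib Require Import FunctionalExtensionality PropExtensionality.
From Stdlib Require Arith.Cantor.
Require Import Defs.
Import ListNotations.

(** * Analytic sets *)

(** Both targets share one fusion argument, which sees Cantor space only through the coordinate
    functions [bit] and the property [splits]. For [G0] the ordinary coordinates serve; for [G1]
    they do not, since [g_map n] can change infinitely many coordinates at once, hence the recoding.
    Labels can be made to increase because the edges with one label run from the complement of a
    Borel set into that set: finitely many labels are destroyed by a finite Borel partition, so a
    set without edges of large label is negligible. [B] is only analytic, so a limit of edges need
    not be an edge. Each edge of a configuration therefore carries a parameter in a closed set
    mapped continuously onto the edges with its label, and the parameters are made to converge
    together with the vertices. The limit map is continuous even when [h] is merely Borel, which
    settles both classes of reductions at once. *)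

Definition agree {T} (n : nat) (a b : nat -> T) : Prop := forall k, k < n -> a k = b k.

Lemma agree_le {T} m n (a b : nat -> T) : m <= n -> agree n a b -> agree m a b.
Proof. intros H Hab k Hk; apply Hab; lia. Qed.

Lemma agree_sym {T} n (a b : nat -> T) : agree n a b -> agree n b a.
Proof. intros H k Hk; symmetry; auto. Qed.

Lemma agree_trans {T} n (a b c : nat -> T) : agree n a b -> agree n b c -> agree n a c.
Proof. intros H H' k Hk; rewrite H by auto; auto. Qed.

Lemma finite_bound (Q : nat -> nat -> Prop) n :
  (forall k m m', m <= m' -> Q k m -> Q k m') ->
  (forall k, k < n -> exists m, Q k m) -> exists m, forall k, k < n -> Q k m.
Proof.
  intros Hm; induction n as [|n IH]; intros H.
  - exists 0; intros; lia.
  - destruct IH as [m Hm1]; [intros; apply H; lia|].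
    destruct (H n) as [m' Hm']; [lia|].
    exists (max m m'); intros k Hk.
    destruct (Nat.eq_dec k n) as [->|].
    + apply (Hm _ m'); [lia|auto].
    + apply (Hm _ m); [lia|apply Hm1; lia].
Qed.

Lemma list_bound {A} (l : list A) (Q : A -> nat -> Prop) :
  (forall x m m', m <= m' -> Q x m -> Q x m') ->
  (forall x, In x l -> exists m, Q x m) -> exists m, forall x, In x l -> Q x m.
Proof.
  intros Hm; induction l as [|x l IH]; intros H.
  - exists 0; intros ? [].
  - destruct IH as [m Hm1]; [intros; apply H; now right|].
    destruct (H x) as [m' Hm']; [now left|].
    exists (max m m'); intros k [<-|Hk].
    + apply (Hm _ m'); [lia|auto].
    + apply (Hm _ m); [lia|auto].
Qed.

Definition hausdorff (X : TopSp) : Prop := forall x y : pt X, x <> y ->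
  exists U V, opn X U /\ opn X V /\ U x /\ V y /\ forall z, U z -> V z -> False.

Lemma continuous_comp (X Y Z : TopSp) f g :
  continuous X Y f -> continuous Y Z g -> continuous X Z (fun x => g (f x)).
Proof. intros Hf Hg V HV. exact (Hf _ (Hg V HV)). Qed.

(* [baire_open] and [cantor_open] are both the instance of this notion of openness at their type. *)
Lemma coordinatewise_open {T} (f : (nat -> nat) -> nat -> T) (V : (nat -> T) -> Prop) :
  (forall a n, exists m, forall b, agree m b a -> f b n = f a n) ->
  (forall c, V c -> exists n, forall d, (forall k, k < n -> d k = c k) -> V d) ->
  baire_open (fun a => V (f a)).
Proof.
  intros H HV a Va. destruct (HV _ Va) as [n Hn].
  destruct (finite_bound (fun k m => forall b, agree m b a -> f b k = f a k) n) as [m Hm].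
  - intros k m m' Hle Hk b Hb; apply Hk; eapply agree_le; eauto.
  - intros; apply H.
  - exists m; intros b Hb; apply Hn; intros k Hk; apply Hm; auto.
Qed.

Lemma baire_continuous (f : (nat -> nat) -> nat -> nat) :
  (forall a n, exists m, forall b, agree m b a -> f b n = f a n) -> continuous Baire Baire f.
Proof. intros H V HV. now apply coordinatewise_open. Qed.

Lemma cantor_continuous (f : (nat -> nat) -> nat -> bool) :
  (forall a n, exists m, forall b, agree m b a -> f b n = f a n) -> continuous Baire Cantor f.
Proof. intros H V HV. now apply coordinatewise_open. Qed.

Lemma baire_continuous_agree (f : (nat -> nat) -> nat -> nat) :
  continuous Baire Baire f -> forall a n, exists m, forall b, agree m b a -> agree n (f b) (f a).
Proof.
  intros H a n.
  destruct (H (fun c => agree n c (f a))) with (a := a) as [m Hm]; cbn.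
  - intros c Hc; exists n; intros b Hb; eapply agree_trans; eauto.
  - intros k _; auto.
  - exists m; auto.
Qed.

Definition closed (D : (nat -> nat) -> Prop) : Prop := baire_open (fun a => ~ D a).

Lemma closed_inter {I : Type} (D : I -> (nat -> nat) -> Prop) :
  (forall i, closed (D i)) -> closed (fun a => forall i, D i a).
Proof.
  intros H a Ha. apply not_all_ex_not in Ha as [i Hi].
  destruct (H i a Hi) as [n Hn]; exists n; intros b Hb Hall; exact (Hn b Hb (Hall i)).
Qed.

Lemma closed_and D E : closed D -> closed E -> closed (fun a => D a /\ E a).
Proof.
  intros HD HE a Ha. apply not_and_or in Ha as [Ha|Ha].
  - destruct (HD a Ha) as [n Hn]; exists n; intros b Hb []; firstorder.
  - destruct (HE a Ha) as [n Hn]; exists n; intros b Hb []; firstorder.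
Qed.

Lemma closed_preimage D f : closed D -> continuous Baire Baire f -> closed (fun a => D (f a)).
Proof. intros HD Hf. exact (Hf _ HD). Qed.

Lemma closed_eq (X : TopSp) (f g : pt Baire -> pt X) : hausdorff X ->
  continuous Baire X f -> continuous Baire X g -> closed (fun a => f a = g a).
Proof.
  intros HX Hf Hg a Ha.
  destruct (HX _ _ Ha) as (U & V & HU & HV & Ua & Va & Hd).
  destruct (Hf U HU a Ua) as [n Hn], (Hg V HV a Va) as [m Hm].
  exists (max n m); intros b Hb Heq; apply (Hd (f b)).
  - apply Hn; intros; apply Hb; lia.
  - rewrite Heq; apply Hm; intros; apply Hb; lia.
Qed.

Lemma closed_local D : (forall a, exists n, forall b, agree n b a -> D b -> D a) -> closed D.
Proof. intros H a Ha. destruct (H a) as [n Hn]. exists n; intros b Hb Db; eauto. Qed.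

(* Countably many elements of Baire space are coded in one, as its columns. *)
Definition col (n : nat) (a : nat -> nat) : nat -> nat := fun k => a (Cantor.to_nat (n, k)).
Definition join (u : nat -> nat -> nat) : nat -> nat :=
  fun z => let (n, k) := Cantor.of_nat z in u n k.

Lemma col_join n u : col n (join u) = u n.
Proof. extensionality k. unfold col, join. now rewrite Cantor.cancel_of_to. Qed.

Lemma col_continuous n : continuous Baire Baire (col n).
Proof.
  apply baire_continuous; intros a k. exists (S (Cantor.to_nat (n, k))).
  intros b Hb; apply Hb; lia.
Qed.

Definition tail (a : nat -> nat) : nat -> nat := fun k => a (S k).
Definition ncons (n : nat) (a : nat -> nat) : nat -> nat :=
  fun k => match k with 0 => n | S k => a k end.

Lemma tail_continuous : continuous Baire Baire tail.
Proof. apply baire_continuous; intros a k; exists (S (S k)); intros b Hb; apply Hb; lia. Qed.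

Lemma tail_ncons n a : tail (ncons n a) = a.
Proof. reflexivity. Qed.

Lemma branch_continuous (X : TopSp) (f : nat -> pt Baire -> pt X) :
  (forall n, continuous Baire X (f n)) -> continuous Baire X (fun c => f (c 0) (tail c)).
Proof.
  intros Hf V HV a Va.
  destruct (continuous_comp _ _ _ _ _ tail_continuous (Hf (a 0)) V HV a Va) as [n Hn].
  exists (S n); intros b Hb. rewrite (Hb 0) by lia.
  apply Hn; intros; apply Hb; lia.
Qed.

Lemma closed_branch D : (forall n, closed (D n)) -> closed (fun c => D (c 0) (tail c)).
Proof.
  intros HD a Ha. destruct (closed_preimage _ _ (HD (a 0)) tail_continuous a Ha) as [n Hn].
  exists (S n); intros b Hb. rewrite (Hb 0) by lia. apply Hn; intros; apply Hb; lia.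
Qed.

Section Retraction.
Variable D : (nat -> nat) -> Prop.
Hypothesis HD : closed D.
Hypothesis Dne : exists a, D a.

Let meets n a := exists c, D c /\ agree n c a.
Let pick n a := epsilon (inhabits a) (fun c => D c /\ agree n c a).
Let first_exit a n := meets n a /\ ~ meets (S n) a.
Let retr a := match excluded_middle_informative (D a) with
  | left _ => a
  | right _ => pick (epsilon (inhabits 0) (first_exit a)) a end.

Let first_exit_ex a : ~ D a -> exists n, first_exit a n.
Proof.
  intros Ha. destruct (HD a Ha) as [n Hn].
  assert (Hno : ~ meets n a) by (intros (c & Dc & Hc); exact (Hn c Hc Dc)).
  clear Hn. induction n as [|n IH].
  - destruct Dne as [c Dc]; destruct Hno; exists c; split; auto; intros k Hk; lia.
  - destruct (classic (meets n a)); [exists n; split; auto|auto].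
Qed.

Let meets_le m n a : m <= n -> meets n a -> meets m a.
Proof. intros H (c & Dc & Hc); exists c; split; auto; eapply agree_le; eauto. Qed.

Let meets_agree n a b : agree n a b -> meets n a -> meets n b.
Proof. intros H (c & Dc & Hc); exists c; split; auto; eapply agree_trans; eauto. Qed.

Let first_exit_uniq a b m n k : first_exit a m -> first_exit b n -> agree k a b -> m < k -> m = n.
Proof.
  intros [H1 H2] [H3 H4] Hab Hm.
  assert (Hb : meets m b).
  { apply (meets_agree m a); auto. apply (agree_le m k); auto; lia. }
  assert (Hb' : ~ meets (S m) b).
  { intro K; apply H2; apply (meets_agree _ b); auto. apply agree_sym, (agree_le _ k); auto. }
  destruct (lt_eq_lt_dec m n) as [[h|h]|h]; auto.
  - destruct Hb'; apply (meets_le _ n); auto.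
  - destruct H4; apply (meets_le _ m); auto.
Qed.

(** The image of a point outside [D] is a chosen point of [D] sharing with it the longest prefix
    that [D] meets. Nearby points outside [D] have the same such prefix, hence the same image; near
    a point of [D] this prefix is long, hence the image close. *)
Lemma closed_retract :
  exists r, continuous Baire Baire r /\ (forall a, D (r a)) /\ forall a, D a -> r a = a.
Proof.
  assert (pickP : forall n a, meets n a -> D (pick n a) /\ agree n (pick n a) a).
  { intros n a H; apply (epsilon_spec (inhabits a) (fun c => D c /\ agree n c a)); exact H. }
  assert (pickE : forall n a b, meets n a -> agree n a b -> pick n a = pick n b).
  { intros n a b Hne Hab. unfold pick.
    (* Points with a common prefix give the same predicate, by extensionality, and [epsilon]
       respects equality of predicates; the default inhabitants still differ and are exchanged
       afterwards. *)
    assert ((fun c => D c /\ agree n c a) = (fun c => D c /\ agree n c b)) as ->.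
    { extensionality c. apply propositional_extensionality.
      split; intros [Dc Hc]; split; auto; eapply agree_trans; eauto; now apply agree_sym. }
    apply epsilon_inh_irrelevance.
    destruct Hne as (c & Dc & Hc); exists c; split; auto; eapply agree_trans; eauto. }
  exists retr; repeat split.
  - apply baire_continuous. intros a n. unfold retr.
    destruct (excluded_middle_informative (D a)) as [Da|Da].
    + exists (S n). intros b Hb. destruct (excluded_middle_informative (D b)) as [Db|Db].
      * apply Hb; lia.
      * pose proof (epsilon_spec (inhabits 0) _ (first_exit_ex b Db)) as Hm.
        set (m := epsilon _ _) in *. destruct Hm as [Hm Hm'].
        assert (n < m).
        { destruct (le_lt_dec m n); auto. destruct Hm'.
          exists a; split; auto. apply agree_sym, (agree_le _ (S n)); auto; lia. }
        destruct (pickP m b Hm) as [_ Hp]. rewrite Hp by auto. apply Hb; lia.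
    + pose proof (epsilon_spec (inhabits 0) _ (first_exit_ex a Da)) as Hm.
      set (m := epsilon _ (first_exit a)) in *.
      exists (S m). intros b Hb.
      destruct (excluded_middle_informative (D b)) as [Db|Db].
      * destruct Hm as [_ []]. exists b; split; auto.
      * pose proof (epsilon_spec (inhabits 0) _ (first_exit_ex b Db)) as Hk.
        set (k := epsilon _ (first_exit b)) in *.
        assert (m = k) as <- by (eapply first_exit_uniq; eauto; now apply agree_sym).
        rewrite (pickE m b a); auto.
        -- apply Hk.
        -- apply (agree_le _ (S m)); auto.
  - intros a; unfold retr. destruct (excluded_middle_informative (D a)) as [Da|Da]; auto.
    apply pickP. apply (epsilon_spec (inhabits 0) _ (first_exit_ex a Da)).
  - intros a Da; unfold retr. destruct (excluded_middle_informative (D a)); tauto.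
Qed.
End Retraction.

(** [analytic] asks for an image of the whole Baire space. A parametrization by a nonempty closed
    set is precomposed with the retraction; an empty one falls under the first alternative. *)
Lemma analytic_of_closed (X : TopSp) D (f : pt Baire -> pt X) S :
  closed D -> continuous Baire X f -> (forall x, S x <-> exists a, D a /\ f a = x) ->
  analytic X S.
Proof.
  intros HD Hf HS. destruct (classic (exists a, D a)) as [Hne|Hne].
  - destruct (closed_retract D HD Hne) as (r & Hr & HrD & Hid).
    right. exists (fun a => f (r a)); split.
    + exact (continuous_comp Baire Baire X r f Hr Hf).
    + intros x; rewrite HS; split.
      * intros (a & Da & <-); exists a; now rewrite Hid.
      * intros (a & <-); exists (r a); auto.
  - left; intros x Hx; apply HS in Hx as (a & Da & _); eauto.
Qed.

Lemma const_continuous (X Y : TopSp) (y : pt Y) :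
  opn X (fun _ => True) -> opn X (fun _ => False) -> continuous X Y (fun _ => y).
Proof.
  intros H H' V HV. destruct (classic (V y)) as [Vy|Vy].
  - replace (fun _ : pt X => V y) with (fun _ : pt X => True); auto.
    extensionality x; apply propositional_extensionality; tauto.
  - replace (fun _ : pt X => V y) with (fun _ : pt X => False); auto.
    extensionality x; apply propositional_extensionality; tauto.
Qed.

Lemma analytic_closed (X : TopSp) S : inhabited (pt X) -> analytic X S ->
  exists D f, closed D /\ continuous Baire X f /\ forall x, S x <-> exists a, D a /\ f a = x.
Proof.
  intros [x0] [HS|(f & Hf & HS)].
  - exists (fun _ => False), (fun _ => x0). split; [|split].
    + intros a _; exists 0; auto.
    + apply const_continuous; intros a; [exists 0; auto|intros []].
    + intro x; split; [intros Hx; destruct (HS x Hx)|intros (? & [] & _)].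
  - exists (fun _ => True), f. split; [|split]; auto.
    + intros a []; auto.
    + intro x; rewrite HS; firstorder.
Qed.

Lemma analytic_ext (X : TopSp) S S' : (forall x, S x <-> S' x) -> analytic X S -> analytic X S'.
Proof.
  intros H. replace S' with S; auto. extensionality x; now apply propositional_extensionality.
Qed.

Lemma borel_ext (X : TopSp) S S' : (forall x, S x <-> S' x) -> borel X S -> borel X S'.
Proof.
  intros H. replace S' with S; auto. extensionality x; now apply propositional_extensionality.
Qed.

(** The first entry of the parameter chooses [n], and its tail parametrizes [S n]. *)
Lemma analytic_cunion (X : TopSp) (S : nat -> pt X -> Prop) :
  (forall n, analytic X (S n)) -> analytic X (fun x => exists n, S n x).
Proof.
  intros H. destruct (classic (inhabited (pt X))) as [Hi|Hi].
  2: left; intros x; destruct Hi; now constructor.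
  assert (K := fun n => analytic_closed X (S n) Hi (H n)).
  apply choice in K as [D K]. apply choice in K as [f K].
  apply (analytic_of_closed X (fun c => D (c 0) (tail c)) (fun c => f (c 0) (tail c))).
  - apply closed_branch; apply K.
  - apply branch_continuous; apply K.
  - intros x; split.
    + intros (n & Hx). apply K in Hx as (a & Da & Ha). now exists (ncons n a).
    + intros (c & Dc & Hc). exists (c 0). apply K; eauto.
Qed.

(** Each column parametrizes a point of one of the sets; that all these points coincide is a closed
    condition because [X] is Hausdorff. *)
Lemma analytic_cinter (X : TopSp) (S : nat -> pt X -> Prop) : hausdorff X ->
  (forall n, analytic X (S n)) -> analytic X (fun x => forall n, S n x).
Proof.
  intros HX H. destruct (classic (inhabited (pt X))) as [Hi|Hi].
  2: left; intros x; destruct Hi; now constructor.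
  assert (K := fun n => analytic_closed X (S n) Hi (H n)).
  apply choice in K as [D K]. apply choice in K as [f K].
  apply (analytic_of_closed X
    (fun c => forall n, D n (col n c) /\ f n (col n c) = f 0 (col 0 c))
    (fun c => f 0 (col 0 c))).
  - apply closed_inter; intro n; apply closed_and.
    + apply (closed_preimage _ (col n)); [apply K|apply col_continuous].
    + apply closed_eq; auto.
      * apply (continuous_comp Baire Baire X (col n) (f n)); [apply col_continuous|apply K].
      * apply (continuous_comp Baire Baire X (col 0) (f 0)); [apply col_continuous|apply K].
  - apply (continuous_comp Baire Baire X (col 0) (f 0)); [apply col_continuous|apply K].
  - intros x; split.
    + intros Hx.
      assert (L : forall n, exists a, D n a /\ f n a = x) by (intro n; apply K; auto).
      apply choice in L as [u Hu]. exists (join u). split.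
      * intro n; rewrite !col_join. split; [apply Hu|]. now rewrite !(proj2 (Hu _)).
      * rewrite col_join; apply Hu.
    + intros (c & Hc & <-) n. apply K. exists (col n c). apply Hc.
Qed.

Lemma analytic_and (X : TopSp) (P Q : pt X -> Prop) : hausdorff X ->
  analytic X P -> analytic X Q -> analytic X (fun x => P x /\ Q x).
Proof.
  intros HX HP HQ.
  apply analytic_ext with (fun x => forall n : nat, (match n with 0 => P | _ => Q end) x).
  - intro x; split.
    + intros H; split; [apply (H 0)|apply (H 1)].
    + intros [H1 H2] [|]; auto.
  - apply analytic_cinter; auto. intros [|]; auto.
Qed.

Lemma analytic_image (X Y : TopSp) (g : pt X -> pt Y) S :
  continuous X Y g -> analytic X S -> analytic Y (fun y => exists x, S x /\ g x = y).
Proof.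
  intros Hg [HS|(f & Hf & HS)].
  - left; intros y (x & Hx & _); firstorder.
  - right. exists (fun a => g (f a)); split.
    + exact (continuous_comp Baire X Y f g Hf Hg).
    + intros y; split.
      * intros (x & Hx & <-). apply HS in Hx as [a <-]; eauto.
      * intros [a <-]; exists (f a); split; auto; apply HS; eauto.
Qed.

(** * Borel sets and their analyticity *)

Lemma borel_preimage (X Y : TopSp) (g : pt X -> pt Y) S :
  borel_fun X Y g -> borel Y S -> borel X (fun x => S (g x)).
Proof.
  intros Hg HS; induction HS as [U HU|U HU IH|F HF IH].
  - exact (Hg U HU).
  - now apply borel_compl.
  - now apply (borel_cunion X (fun n x => F n (g x))).
Qed.

Lemma continuous_borel_fun (X Y : TopSp) g : continuous X Y g -> borel_fun X Y g.
Proof. intros H V HV. apply borel_open. exact (H V HV). Qed.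

Lemma borel_cinter (X : TopSp) (F : nat -> pt X -> Prop) :
  (forall n, borel X (F n)) -> borel X (fun x => forall n, F n x).
Proof.
  intros H. apply borel_ext with (fun x => ~ exists n, ~ F n x).
  - intros x; split.
    + intros K n. apply NNPP; intro; eauto.
    + intros K [n Hn]; auto.
  - apply borel_compl, borel_cunion. intro; now apply borel_compl.
Qed.

Lemma borel_and (X : TopSp) (P Q : pt X -> Prop) :
  borel X P -> borel X Q -> borel X (fun x => P x /\ Q x).
Proof.
  intros HP HQ.
  apply borel_ext with (fun x => forall n : nat, (match n with 0 => P | _ => Q end) x).
  - intro x; split.
    + intros H; split; [apply (H 0)|apply (H 1)].
    + intros [H1 H2] [|]; auto.
  - apply borel_cinter; auto. intros [|]; auto.
Qed.

Lemma borel_or (X : TopSp) (P Q : pt X -> Prop) :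
  borel X P -> borel X Q -> borel X (fun x => P x \/ Q x).
Proof.
  intros HP HQ.
  apply borel_ext with (fun x => exists n : nat, (match n with 0 => P | _ => Q end) x).
  - intro x; split.
    + intros [[|] H]; auto.
    + intros [H|H]; [now exists 0|now exists 1].
  - apply borel_cunion; auto. intros [|]; auto.
Qed.

(** The induction carries complements along, since analytic sets are stable under countable unions
    and intersections but not under complementation. *)
Lemma borel_analytic (X : TopSp) S : hausdorff X -> analytic X (fun _ => True) ->
  borel X S -> analytic X S /\ analytic X (fun x => ~ S x).
Proof.
  intros HX HA HS; induction HS as [U HU|U HU IH|F HF IH].
  - destruct HA as [HA|(q & Hq & Hs)].
    { split; left; intros x; destruct (HA x I). }
    assert (Ho : baire_open (fun a => U (q a))) by exact (Hq U HU).
    split.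
    + (* the first entry of [c] is a length at which [tail c] is certified to lie in the open set *)
      apply (analytic_of_closed X
        (fun c => forall b, agree (c 0) b (tail c) -> U (q b)) (fun c => q (tail c))).
      * apply closed_local. intros a. exists (S (a 0)). intros b Hb Db x Hx.
        apply Db. rewrite (Hb 0) by lia. intros k Hk. rewrite Hx by auto.
        unfold tail. symmetry; apply Hb; lia.
      * exact (continuous_comp Baire Baire X tail q tail_continuous Hq).
      * intros x; split.
        -- intros Ux. destruct (proj1 (Hs x) I) as [a Ha].
           destruct (Ho a) as [n Hn]; [now rewrite Ha|].
           exists (ncons n a); split; auto.
        -- intros (c & Hc & <-). apply Hc. intros k _; auto.
    + apply (analytic_of_closed X (fun c => ~ U (q c)) q); auto.
      * intros a Ha. apply NNPP in Ha. destruct (Ho a Ha) as [n Hn]; exists n; intros b Hb Hb'.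
        apply Hb', Hn, Hb.
      * intros x; split.
        -- intros Ux. destruct (proj1 (Hs x) I) as [a <-]; eauto.
        -- intros (c & Hc & <-); auto.
  - destruct IH as [H1 H2]; split; auto.
    apply analytic_ext with U; auto. intro x; split; [tauto|apply NNPP].
  - split.
    + apply analytic_cunion; apply IH.
    + apply analytic_ext with (fun x => forall n, ~ F n x).
      * intros x; split; [intros H [n Hn]; firstorder|intros H n Hn; eauto].
      * apply analytic_cinter; auto; apply IH.
Qed.

Lemma baire_hausdorff : hausdorff Baire.
Proof.
  intros a b Hab. assert (exists n, a n <> b n) as [n Hn].
  { apply NNPP; intro H; apply Hab; extensionality n. apply NNPP; intro; eauto. }
  exists (fun c => c n = a n), (fun c => c n = b n); repeat split; auto.
  - intros c Hc; exists (S n); intros d Hd; rewrite Hd by lia; auto.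
  - intros c Hc; exists (S n); intros d Hd; rewrite Hd by lia; auto.
  - intros z H1 H2; congruence.
Qed.

Lemma baire_analytic : analytic Baire (fun _ => True).
Proof. right; exists (fun a => a); split; [intros V HV; exact HV|].
  intro x; split; eauto. Qed.

(** * Polish spaces and Lusin separation *)

Section Metric.
Variable Y : Polish.
Local Open Scope R_scope.
Local Notation d := (P_dist Y).

Lemma dist_refl x : d x x = 0.
Proof. now apply P_dist_eq0. Qed.

Lemma dist_pos x y : x <> y -> 0 < d x y.
Proof.
  intros H. destruct (P_dist_nonneg Y x y) as [K|K]; auto.
  destruct H. apply (P_dist_eq0 Y). auto.
Qed.

Lemma ball_open x r : metric_open Y (fun y => d x y < r).
Proof.
  intros y Hy. exists (r - d x y); split; [lra|]. intros z Hz.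
  pose proof (P_dist_tri Y x y z); lra.
Qed.

Lemma polish_hausdorff : hausdorff Y.
Proof.
  intros x y Hxy. pose proof (dist_pos x y Hxy) as Hp.
  exists (fun z => d x z < d x y / 2), (fun z => d y z < d x y / 2).
  repeat split; try apply ball_open; rewrite ?dist_refl; try lra.
  intros z H1 H2. pose proof (P_dist_tri Y x z y). rewrite (P_dist_sym Y z y) in H. lra.
Qed.

Lemma continuous_dist (f : pt Baire -> pt Y) : continuous Baire Y f <->
  forall a eps, 0 < eps -> exists n, forall b, agree n b a -> d (f a) (f b) < eps.
Proof.
  split.
  - intros Hf a eps He.
    apply (Hf (fun y => d (f a) y < eps)); [apply ball_open|].
    rewrite dist_refl; auto.
  - intros H V HV a Va. destruct (HV _ Va) as (eps & He & Hb).
    destruct (H a eps He) as [n Hn]. exists n; intros b Hab. exact (Hb _ (Hn b Hab)).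
Qed.

Lemma half_pow_pos n : 0 < (1/2)^n.
Proof. apply pow_lt; lra. Qed.

Lemma half_pow_le n m : (n <= m)%nat -> (1/2)^m <= (1/2)^n.
Proof.
  intro H. replace m with (n + (m - n))%nat by lia. rewrite pow_add, <- Rmult_1_r.
  apply Rmult_le_compat_l; [pose proof (half_pow_pos n); lra|].
  pose proof (pow_incr (1/2) 1 (m - n) ltac:(lra)) as K. now rewrite pow1 in K.
Qed.

Lemma half_pow_small eps : 0 < eps -> exists n, (1/2)^n < eps.
Proof.
  intros He. destruct (pow_lt_1_zero (1/2)) with (y := eps) as [N HN]; auto.
  - rewrite Rabs_right; lra.
  - exists N. specialize (HN N (Nat.le_refl _)). apply Rabs_def2 in HN; lra.
Qed.

Lemma geometric_limit (C : R) (u : nat -> Y) : 0 < C ->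
  (forall n m, (n <= m)%nat -> d (u n) (u m) <= C * (1/2)^n) ->
  exists l, forall n, d (u n) l <= C * (1/2)^n.
Proof.
  intros HC H.
  destruct (P_complete Y u) as [l Hl].
  - intros eps He. destruct (half_pow_small (eps / (2 * C))) as [N HN].
    { apply Rdiv_lt_0_compat; lra. }
    assert (K : C * (1/2)^N < eps / 2).
    { apply Rmult_lt_compat_l with (r := C) in HN; auto.
      replace (C * (eps / (2 * C))) with (eps / 2) in HN by (field; lra). auto. }
    exists N. intros m n Hm Hn.
    pose proof (H N m Hm). pose proof (H N n Hn).
    pose proof (P_dist_tri Y (u m) (u N) (u n)).
    rewrite (P_dist_sym Y (u m) (u N)) in H2. lra.
  - exists l. intros n. apply Rle_plus_epsilon. intros eps He.
    destruct (Hl eps He) as [N HN].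
    pose proof (HN (max n N) (Nat.le_max_r _ _)).
    pose proof (H n (max n N) (Nat.le_max_l _ _)).
    pose proof (P_dist_tri Y (u n) (u (max n N)) l). lra.
Qed.

Lemma polish_analytic : analytic Y (fun _ => True).
Proof.
  destruct (classic (inhabited Y)) as [[y0]|Hi].
  2: left; intros x; destruct Hi; now constructor.
  destruct (P_separable Y) as [s Hs].
  (* A sequence of indices is read as instructions to move within a dense set; illegal moves are ignored. *)
  pose (next := fun n z i => match s i with
    | Some y => if Rlt_dec (d z y) ((1/2)^n) then y else z | None => z end).
  pose (z := fun a : nat -> nat => fix z n := match n with
    | O => match s (a O) with Some y => y | None => y0 end
    | S m => next m (z m) (a (S m)) end).
  assert (Hstep : forall a n, d (z a n) (z a (S n)) <= (1/2)^n).
  { intros a n. change (z a (S n)) with (next n (z a n) (a (S n))). unfold next.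
    pose proof (half_pow_pos n).
    destruct (s (a (S n))) as [y|]; [destruct (Rlt_dec _ _)|]; rewrite ?dist_refl; lra. }
  assert (Hc : forall a n m, (n <= m)%nat -> d (z a n) (z a m) <= 2 * (1/2)^n).
  { intros a n m Hnm.
    assert (d (z a n) (z a m) <= 2 * (1/2)^n - 2 * (1/2)^m); [|pose proof (half_pow_pos m); lra].
    induction Hnm as [|m Hnm IH]; [rewrite dist_refl; lra|].
    pose proof (P_dist_tri Y (z a n) (z a m) (z a (S m))).
    pose proof (Hstep a m). change ((1/2)^S m) with (1/2 * (1/2)^m). lra. }
  assert (L : forall a, exists l, forall n, d (z a n) l <= 2 * (1/2)^n).
  { intro a; apply geometric_limit; auto; lra. }
  apply choice in L as [f Hf].
  right. exists f. split.
  - apply continuous_dist. intros a eps He.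
    destruct (half_pow_small (eps/4)) as [n Hn]; [lra|].
    exists (S n). intros b Hb.
    assert (E : forall m, (m <= n)%nat -> z b m = z a m).
    { induction m as [|m IH]; intros Hm; simpl.
      - rewrite Hb by lia; auto.
      - rewrite IH, Hb by lia; auto. }
    pose proof (Hf a n). pose proof (Hf b n). rewrite (E n) in H0 by lia.
    pose proof (P_dist_tri Y (f a) (z a n) (f b)). rewrite (P_dist_sym Y (f a) (z a n)) in H1. lra.
  - intros x; split; auto. intros _.
    (* With the bound [(1/2)^n / 3], consecutive approximations of [x] are closer than [(1/2)^n], so
       no instruction is ignored. *)
    assert (K : forall n, exists i, exists y, s i = Some y /\ d x y < (1/2)^n / 3).
    { intros n. destruct (Hs x ((1/2)^n / 3)) as (i & y & H1 & H2); eauto.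
      pose proof (half_pow_pos n); lra. }
    apply choice in K as [a Ha]. exists a.
    assert (Hz : forall n, d x (z a n) < (1/2)^n / 3).
    { induction n as [|n IH].
      - destruct (Ha O) as (y & H1 & H2). cbn [z]. rewrite H1. auto.
      - change (z a (S n)) with (next n (z a n) (a (S n))). unfold next.
        destruct (Ha (S n)) as (y & H1 & H2). rewrite H1.
        destruct (Rlt_dec _ _) as [_|Hno]; auto. destruct Hno.
        pose proof (P_dist_tri Y (z a n) x y). rewrite (P_dist_sym Y (z a n) x) in H.
        change ((1/2)^S n) with (1/2 * (1/2)^n) in H2. pose proof (half_pow_pos n). lra. }
    apply (P_dist_eq0 Y). apply Rle_antisym; [|apply P_dist_nonneg].
    apply Rle_plus_epsilon. intros eps He. destruct (half_pow_small (eps/3)) as [n Hn]; [lra|].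
    pose proof (Hz n). pose proof (Hf a n). pose proof (P_dist_tri Y x (z a n) (f a)).
    rewrite (P_dist_sym Y (f a) x). pose proof (half_pow_pos n). lra.
Qed.
End Metric.

Lemma pair_continuous (X Y : TopSp) (f : pt Baire -> pt X) (g : pt Baire -> pt Y) :
  continuous Baire X f -> continuous Baire Y g -> continuous Baire (prodT X Y) (fun a => (f a, g a)).
Proof.
  intros Hf Hg V HV a Va. destruct (HV _ Va) as (U & W & HU & HW & Ua & Wa & H).
  destruct (Hf U HU a Ua) as [n Hn], (Hg W HW a Wa) as [m Hm].
  exists (max n m). intros b Hb. apply H; [apply Hn|apply Hm]; intros; apply Hb; lia.
Qed.

(** * Products of two Polish spaces *)

Section Product.
Variables X Y : Polish.

Lemma fst_continuous : continuous (prodT X Y) X fst.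
Proof.
  intros V HV p Vp. exists V, (fun _ => True). repeat split; auto.
  intros x _. exists 1%R; split; auto. lra.
Qed.

Lemma snd_continuous : continuous (prodT X Y) Y snd.
Proof.
  intros V HV p Vp. exists (fun _ => True), V. repeat split; auto.
  intros x _. exists 1%R; split; auto. lra.
Qed.

Lemma prod_hausdorff : hausdorff (prodT X Y).
Proof.
  intros [x y] [x' y'] Hne.
  destruct (classic (x = x')) as [->|Hx].
  - assert (y <> y') as Hy by congruence.
    destruct (polish_hausdorff Y _ _ Hy) as (U & V & HU & HV & Uy & Vy & H).
    exists (fun p => U (snd p)), (fun p => V (snd p)); repeat split; auto.
    + exact (snd_continuous U HU).
    + exact (snd_continuous V HV).
    + intros [? ?]; apply H.
  - destruct (polish_hausdorff X _ _ Hx) as (U & V & HU & HV & Uy & Vy & H).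
    exists (fun p => U (fst p)), (fun p => V (fst p)); repeat split; auto.
    + exact (fst_continuous U HU).
    + exact (fst_continuous V HV).
    + intros [? ?]; apply H.
Qed.

Lemma rectangle_analytic (P : X -> Prop) (Q : Y -> Prop) : analytic X P -> analytic Y Q ->
  analytic (prodT X Y) (fun p => P (fst p) /\ Q (snd p)).
Proof.
  intros [H|(f & Hf & Hfs)]; [left; intros [x y] [Hx _]; exact (H x Hx)|].
  intros [H|(g & Hg & Hgs)]; [left; intros [x y] [_ Hy]; exact (H y Hy)|].
  right. exists (fun a => (f (col 0 a), g (col 1 a))). split.
  - apply pair_continuous.
    + exact (continuous_comp Baire Baire X _ _ (col_continuous 0) Hf).
    + exact (continuous_comp Baire Baire Y _ _ (col_continuous 1) Hg).
  - intros [x y]; cbn. split.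
    + intros [Hx Hy]. apply Hfs in Hx as [a <-]. apply Hgs in Hy as [b <-].
      exists (join (fun n => match n with 0 => a | _ => b end)). now rewrite !col_join.
    + intros [a E]. injection E as <- <-. split; [apply Hfs|apply Hgs]; eauto.
Qed.

Lemma prod_analytic : analytic (prodT X Y) (fun _ => True).
Proof.
  apply analytic_ext with (fun p => True /\ True); [tauto|].
  apply (rectangle_analytic (fun _ => True) (fun _ => True)); apply polish_analytic.
Qed.
End Product.

(** * Lusin separation *)

Section Separation.
Variable X : TopSp.
Hypothesis HX : hausdorff X.

Definition separable (P Q : pt X -> Prop) : Prop :=
  exists S, borel X S /\ (forall x, P x -> S x) /\ (forall x, Q x -> ~ S x).

(** The union over [n] of the intersections over [m] of the sets separating [P n] from [Q m] does
    it. Contrapositively, inseparable unions have an inseparable pair of pieces, which drives the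
    descent in [lusin_separation]. *)
Lemma separable_cunion (P Q : nat -> pt X -> Prop) (P0 Q0 : pt X -> Prop) :
  (forall x, P0 x -> exists n, P n x) -> (forall x, Q0 x -> exists n, Q n x) ->
  (forall n m, separable (P n) (Q m)) -> separable P0 Q0.
Proof.
  intros HP HQ H.
  assert (K : forall n, exists S : nat -> pt X -> Prop, forall m,
    borel X (S m) /\ (forall x, P n x -> S m x) /\ (forall x, Q m x -> ~ S m x)).
  { intro n. exact (choice _ (H n)). }
  apply choice in K as [S HS].
  exists (fun x => exists n, forall m, S n m x). split; [|split].
  - apply borel_cunion; intro n. apply borel_cinter; intro m. apply HS.
  - intros x Px. apply HP in Px as [n Pn]. exists n; intro m. now apply (HS n m).
  - intros x Qx [n Hn]. apply HQ in Qx as [m Qm]. exact (proj2 (proj2 (HS n m)) x Qm (Hn m)).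
Qed.

Definition starts (s : list nat) (a : nat -> nat) : Prop :=
  forall k, k < length s -> a k = nth k s 0.

Lemma starts_snoc s a : starts s a -> starts (s ++ [a (length s)]) a.
Proof.
  intros H k Hk. rewrite length_app in Hk; cbn in Hk.
  destruct (Nat.eq_dec k (length s)) as [->|].
  - rewrite app_nth2 by lia. now rewrite Nat.sub_diag.
  - rewrite app_nth1 by lia. apply H; lia.
Qed.

Lemma starts_limit (s : nat -> list nat) :
  s 0 = [] -> (forall k, exists n, s (S k) = s k ++ [n]) ->
  exists a, forall k b, starts (s k) b <-> agree k b a.
Proof.
  intros H0 HS.
  assert (Hl : forall k, length (s k) = k).
  { induction k as [|k IH]; [now rewrite H0|]. destruct (HS k) as [n ->].
    rewrite length_app, IH; cbn; lia. }
  exists (fun k => nth k (s (S k)) 0).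
  assert (E : forall k j, j < k -> nth j (s k) 0 = nth j (s (S j)) 0).
  { induction k as [|k IH]; intros j Hj; [lia|].
    destruct (Nat.eq_dec j k) as [->|]; auto.
    rewrite <- IH by lia. destruct (HS k) as [i ->]. rewrite app_nth1; auto. rewrite Hl; lia. }
  intros k b; unfold starts, agree. rewrite Hl.
  split; intros H j Hj; rewrite H by auto; [|symmetry]; apply E; auto.
Qed.

(** If the images were inseparable, two prefixes could be lengthened one entry at a time with the
    images of their basic sets staying inseparable. At the limit branches [a] and [b], disjoint
    neighbourhoods of [f a] and [g b] separate the images for long enough prefixes, a
    contradiction. *)
Theorem lusin_separation (f g : pt Baire -> pt X) :
  continuous Baire X f -> continuous Baire X g -> (forall a b, f a <> g b) ->
  separable (fun x => exists a, f a = x) (fun x => exists a, g a = x).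
Proof.
  intros Hf Hg Hd. apply NNPP; intro Hno.
  pose (P := fun (s : list nat) x => exists a, starts s a /\ f a = x).
  pose (Q := fun (s : list nat) x => exists a, starts s a /\ g a = x).
  pose (bad := fun st => ~ separable (P (fst st)) (Q (snd st))).
  assert (Hext : forall st : {st | bad st}, exists st' : {st | bad st}, exists n m,
    proj1_sig st' = (fst (proj1_sig st) ++ [n], snd (proj1_sig st) ++ [m])).
  { intros [[s t] Hst]; cbn. apply NNPP; intro H. apply Hst; cbn.
    apply (separable_cunion (fun n => P (s ++ [n])) (fun m => Q (t ++ [m]))).
    - intros x (a & Ha & Hx). exists (a (length s)), a. split; auto. now apply starts_snoc.
    - intros x (a & Ha & Hx). exists (a (length t)), a. split; auto. now apply starts_snoc.
    - intros n m. apply NNPP; intro Hnm. apply H.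
      exists (exist _ (s ++ [n], t ++ [m]) Hnm), n, m; auto. }
  apply choice in Hext as [next Hnext].
  assert (Hroot : bad ([], [])).
  { intros (S & HS & H1 & H2). apply Hno. exists S; split; [|split]; auto.
    - intros x [a Ha]; apply H1. exists a; split; auto. intros k Hk; cbn in Hk; lia.
    - intros x [a Ha]; apply H2. exists a; split; auto. intros k Hk; cbn in Hk; lia. }
  pose (st := fix st (n : nat) : {st | bad st} :=
    match n with 0 => exist (fun st => bad st) _ Hroot | S n => next (st n) end).
  destruct (starts_limit (fun n => fst (proj1_sig (st n)))) as [a Ha]; auto.
  { intro k. destruct (Hnext (st k)) as (n & m & E). exists n.
    change (st (S k)) with (next (st k)). now rewrite E. }
  destruct (starts_limit (fun n => snd (proj1_sig (st n)))) as [b Hb]; auto.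
  { intro k. destruct (Hnext (st k)) as (n & m & E). exists m.
    change (st (S k)) with (next (st k)). now rewrite E. }
  destruct (HX _ _ (Hd a b)) as (U & V & HU & HV & Ua & Vb & Hdis).
  destruct (Hf U HU a Ua) as [n Hn], (Hg V HV b Vb) as [m Hm].
  destruct (st (max n m)) as [[s t] Hst] eqn:E.
  specialize (Ha (max n m)); specialize (Hb (max n m)). rewrite E in Ha, Hb; cbn in Ha, Hb.
  apply Hst. exists U; split; [now apply borel_open|split].
  - intros x (c & Hc & <-). apply Hn. apply Ha in Hc. intros; apply Hc; lia.
  - intros x (c & Hc & <-) Uc. apply (Hdis _ Uc). apply Hm. apply Hb in Hc. intros; apply Hc; lia.
Qed.
End Separation.

Lemma polish_borel_analytic (Y : Polish) S : borel Y S -> analytic Y S.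
Proof. intro; apply borel_analytic; auto using polish_hausdorff, polish_analytic. Qed.

Lemma prod_borel_analytic (X Y : Polish) S : borel (prodT X Y) S -> analytic (prodT X Y) S.
Proof. intro; apply borel_analytic; auto using prod_hausdorff, prod_analytic. Qed.

Lemma borel_const (Y : Polish) (P : Prop) : borel Y (fun _ => P).
Proof.
  apply borel_open. intros x Hx. exists 1%R; split; auto. lra.
Qed.

Lemma polish_separation (Y : Polish) (P Q : Y -> Prop) :
  analytic Y P -> analytic Y Q -> (forall x, P x -> Q x -> False) -> separable Y P Q.
Proof.
  intros [HP|(f & Hf & HP)] HQ Hd.
  { exists (fun _ => False); split; [apply (borel_const Y)|split]; [exact HP|auto]. }
  destruct HQ as [HQ|(g & Hg & HQ)].
  { exists (fun _ => True); split; [apply (borel_const Y)|split]; auto. intros x Qx; destruct (HQ x Qx). }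
  destruct (lusin_separation Y (polish_hausdorff Y) f g Hf Hg) as (S & HS & H1 & H2).
  { intros a b E. apply (Hd (f a)); [apply HP; eauto|rewrite E; apply HQ; eauto]. }
  exists S; split; [|split]; auto.
  - intros x Px; apply H1, HP, Px.
  - intros x Px; apply H2, HQ, Px.
Qed.

Definition independent {T} (R : T -> T -> Prop) (A : T -> Prop) : Prop :=
  forall x y, A x -> A y -> ~ R x y.

(* Separate [A] from its set of successors, then from the predecessors of the separating set. *)
Lemma independent_borel_hull (Y : Polish) (R : Y -> Y -> Prop) (A : Y -> Prop) :
  analytic_rel Y R -> analytic Y A -> independent R A ->
  exists S : Y -> Prop, borel Y S /\ (forall x, A x -> S x) /\ independent R S.
Proof.
  intros HR HA Hind.
  assert (Hsucc : forall P : Y -> Prop, analytic Y P -> analytic Y (fun z => exists x, P x /\ R x z)).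
  { intros P HP.
    apply analytic_ext with (fun z => exists p, ((P (fst p) /\ True) /\ R (fst p) (snd p)) /\ snd p = z).
    - intro z; split; [intros ([x y] & [[? _] ?] & <-); eauto|]. intros (x & []); exists (x, z); auto.
    - apply (analytic_image (prodT Y Y) Y snd); [apply snd_continuous|].
      apply analytic_and; [apply prod_hausdorff| |exact HR].
      apply (rectangle_analytic Y Y P (fun _ => True)); auto using polish_analytic. }
  assert (Hpred : forall P : Y -> Prop, analytic Y P -> analytic Y (fun x => exists z, P z /\ R x z)).
  { intros P HP.
    apply analytic_ext with (fun x => exists p, ((True /\ P (snd p)) /\ R (fst p) (snd p)) /\ fst p = x).
    - intro z; split; [intros ([x y] & [[_ ?] ?] & <-); eauto|]. intros (x & []); exists (z, x); auto.
    - apply (analytic_image (prodT Y Y) Y fst); [apply fst_continuous|].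
      apply analytic_and; [apply prod_hausdorff| |exact HR].
      apply (rectangle_analytic Y Y (fun _ => True) P); auto using polish_analytic. }
  destruct (polish_separation Y A _ HA (Hsucc A HA)) as (S & HS & HAS & HS').
  { intros x Ax (z & Az & Hzx). exact (Hind z x Az Ax Hzx). }
  destruct (polish_separation Y A _ HA (Hpred S (polish_borel_analytic Y S HS))) as (T & HT & HAT & HT').
  { intros x Ax (z & Sz & Hxz). apply (HS' z); eauto. }
  exists (fun x => S x /\ T x). split; [now apply borel_and|split]; auto.
  intros x y [_ Tx] [Sy _] Hxy. apply (HT' x); eauto.
Qed.

(** * The fusion construction *)

Fixpoint words (i : nat) : list (list bool) := match i with
  | 0 => [[]]
  | S i => flat_map (fun s => [s ++ [false]; s ++ [true]]) (words i) end.

Lemma in_words s : In s (words (length s)).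
Proof.
  induction s as [|b s IH] using rev_ind; [now left|].
  rewrite length_app, Nat.add_comm; cbn. apply in_flat_map. exists s; split; auto.
  destruct b; cbn; auto.
Qed.

Lemma borel_list_exists {I} (X : TopSp) (l : list I) (F : I -> pt X -> Prop) :
  borel X (fun _ => False) -> (forall s, borel X (F s)) ->
  borel X (fun x => exists s, In s l /\ F s x).
Proof.
  intros H0 H. induction l as [|s l IH].
  - apply borel_ext with (fun _ => False); firstorder.
  - apply borel_ext with (fun x => F s x \/ exists s, In s l /\ F s x).
    + intro x; split.
      * intros [Hs|(t & Ht & Hx)]; [exists s|exists t]; cbn; auto.
      * intros (t & [<-|Ht] & Hx); eauto.
    + now apply borel_or.
Qed.

Lemma snoc_cases {A} (s : list A) i : length s = S i -> exists s' b, s = s' ++ [b] /\ length s' = i.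
Proof.
  intros H. destruct s as [|b s _] using rev_ind; [discriminate|].
  rewrite length_app in H; cbn in H. exists s, b; split; auto; lia.
Qed.

Fixpoint seq_code (len n : nat) : list nat := match len with
  | 0 => []
  | S len => let (x, m) := Cantor.of_nat n in x :: seq_code len m end.

Lemma seq_code_surj s : exists n, seq_code (length s) n = s.
Proof.
  induction s as [|x s [m Hm]]; [now exists 0|].
  exists (Cantor.to_nat (x, m)); cbn -[Cantor.of_nat Cantor.to_nat].
  rewrite Cantor.cancel_of_to. now rewrite Hm.
Qed.

Definition shift_in (s : list nat) (a : nat -> nat) : nat -> nat :=
  fun k => if k <? length s then nth k s 0 else a (k - length s).

Lemma shift_in_starts s a : starts s (shift_in s a).
Proof. intros k Hk. unfold shift_in. apply Nat.ltb_lt in Hk. now rewrite Hk. Qed.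

Lemma starts_shift_in s a : starts s a -> exists b, a = shift_in s b.
Proof.
  intros H. exists (fun k => a (length s + k)). extensionality k. unfold shift_in.
  destruct (Nat.ltb_spec k (length s)); auto. f_equal; lia.
Qed.

Lemma shift_in_continuous s : continuous Baire Baire (shift_in s).
Proof.
  apply baire_continuous. intros a k. exists (S k). intros b Hb. unfold shift_in.
  destruct (k <? length s); auto. apply Hb; lia.
Qed.

Definition prefix {T} (n : nat) (a : nat -> T) : list T := map a (seq 0 n).

Lemma starts_prefix n a b : starts (prefix n a) b <-> agree n b a.
Proof.
  unfold starts, prefix, agree. rewrite length_map, length_seq.
  split; intros H k Hk; rewrite (H k Hk).
  - rewrite nth_indep with (d' := a 0) by now rewrite length_map, length_seq.
    now rewrite map_nth, seq_nth.
  - rewrite nth_indep with (d' := a 0) by now rewrite length_map, length_seq.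
    now rewrite map_nth, seq_nth.
Qed.

Section Fusion.
Variable Y : Polish.
Variable Bm : nat -> Y -> Y -> Prop.
Variable cut : nat -> Y -> Prop.
Variable G : (nat -> bool) -> (nat -> bool) -> Prop.
Variable bit : nat -> (nat -> bool) -> bool.
Local Notation d := (P_dist Y).

Definition code (i : nat) (x : nat -> bool) : list bool := map (fun j => bit j x) (seq 0 i).

Lemma code_length i x : length (code i x) = i.
Proof. unfold code. now rewrite length_map, length_seq. Qed.

Lemma code_S i x : code (S i) x = code i x ++ [bit i x].
Proof. unfold code. now rewrite seq_S, map_app. Qed.

Lemma code_nth i k x : k < i -> nth k (code i x) false = bit k x.
Proof.
  intro H. unfold code. rewrite nth_indep with (d' := bit 0 x) by now rewrite length_map, length_seq.
  now rewrite (map_nth (fun j => bit j x)), seq_nth.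
Qed.

Lemma code_eq i x y : code i x = code i y <-> forall j, j < i -> bit j x = bit j y.
Proof.
  induction i as [|i IH]; [split; [intros; lia|reflexivity]|].
  rewrite !code_S. split.
  - intros H j Hj. apply app_inj_tail in H as [H H']. rewrite IH in H.
    destruct (Nat.eq_dec j i) as [->|]; auto. apply H; lia.
  - intros H. rewrite (proj2 IH), H by auto. auto.
Qed.

(** The edges of the [i]-th approximation come from edges of [G] whose endpoints are told apart by
    the first [i] bits; [j] is the first bit that does so, and it will determine the label. *)
Definition edge (i j : nat) (s t : list bool) : Prop := exists x y, G x y /\ j < i /\
  code j x = code j y /\ bit j x <> bit j y /\ code i x = s /\ code i y = t.

Definition labelled (i : nat) (lab : nat -> nat) (f : list bool -> Y) : Prop :=
  forall j s t, edge i j s t -> Bm (lab j) (f s) (f t).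

(* [v] is the vertex of the [i]-th finite approximation along which two copies of it are glued to
   form the next one; the last clause says that the copies of the other vertices are identified
   or kept apart as required. *)
Definition splits (i : nat) (v : list bool) : Prop := length v = i /\
  (forall x y, G x y -> code i x = code i y -> bit i x <> bit i y ->
     code i x = v /\ bit i x = false) /\
  forall lab f f', (forall j k, j < k -> k <= i -> lab j < lab k) ->
    labelled i lab f -> labelled i lab f' -> Bm (lab i) (f v) (f' v) ->
    (forall x y, G x y -> code i x <> code i y -> bit i x <> bit i y ->
       f (code i y) = f' (code i y)) /\
    (forall x y, code i x = code i y -> bit i x <> bit i y -> f (code i x) <> f' (code i x)).

Hypothesis Bm_analytic : forall m, analytic_rel Y (Bm m).
Hypothesis cut_borel : forall m, borel Y (cut m).
Hypothesis Bm_cut : forall m x y, Bm m x y -> ~ cut m x /\ cut m y.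
Let B x y := exists m, Bm m x y.
Let negligible_family (F : nat -> Y -> Prop) := forall n, borel Y (F n) /\ independent B (F n).
Hypothesis uncovered : forall F, negligible_family F -> ~ forall y, exists n, F n y.
Hypothesis bit_continuous : forall j x, exists n, forall y, agree n y x -> bit j y = bit j x.
Hypothesis bit_injective : forall x y, (forall j, bit j x = bit j y) -> x = y.
Hypothesis G_irrefl : forall x, ~ G x x.
Hypothesis splits_ex : forall i, exists v, splits i v.

Lemma bits_of (P : nat -> Prop) b : exists j, forall m, m < b -> (P m <-> Nat.testbit j m = true).
Proof.
  induction b as [|b [j Hj]]; [exists 0; intros; lia|].
  destruct (classic (P b)) as [Hb|Hb].
  - exists (Nat.setbit j b). intros m Hm. destruct (Nat.eq_dec m b) as [->|].
    + now rewrite Nat.setbit_eq.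
    + rewrite Nat.setbit_neq by auto. apply Hj; lia.
  - exists (Nat.clearbit j b). intros m Hm. destruct (Nat.eq_dec m b) as [->|].
    + rewrite Nat.clearbit_eq. split; [tauto|discriminate].
    + rewrite Nat.clearbit_neq by auto. apply Hj; lia.
Qed.

(* The finitely many relations of small index are coloured by their cuts. *)
Lemma tail_independent_negligible (A : Y -> Prop) b : analytic Y A ->
  independent (fun x y => exists m, b <= m /\ Bm m x y) A ->
  exists F, negligible_family F /\ forall y, A y -> exists n, F n y.
Proof.
  intros HA Hind.
  destruct (independent_borel_hull Y (fun x y => exists m, b <= m /\ Bm m x y) A)
    as (T & HT & HAT & HTi); auto.
  { apply (analytic_cunion (prodT Y Y) (fun m p => b <= m /\ Bm m (fst p) (snd p))). intro m.
    destruct (le_lt_dec b m) as [h|h].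
    - apply analytic_ext with (2 := Bm_analytic m). intro; tauto.
    - left. intros p []; lia. }
  exists (fun j y => T y /\ forall m, m < b -> (cut m y <-> Nat.testbit j m = true)). split.
  - intro j; split.
    + apply (borel_and Y T); auto. apply (borel_cinter Y). intro m.
      destruct (le_lt_dec b m) as [h|h].
      * apply borel_ext with (fun _ => True); [split; auto; lia|apply (borel_const Y)].
      * destruct (Nat.testbit j m) eqn:E.
        -- apply borel_ext with (2 := cut_borel m). intuition.
        -- apply borel_ext with (2 := borel_compl Y _ (cut_borel m)).
           intro y; split; [intros H _; split; [tauto|discriminate]|].
           intros H K; apply H in K; auto; discriminate.
    + intros x y [Tx Hx] [Ty Hy] [m Hm]. destruct (le_lt_dec b m) as [h|h].
      * apply (HTi x y); eauto.
      * destruct (Bm_cut m x y Hm) as [H1 H2]. apply H1, Hx; auto. apply Hy; auto.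
  - intros y Ay. destruct (bits_of (fun m => cut m y) b) as [j Hj]. exists j; auto.
Qed.

Lemma negligible_countable (F : nat -> nat -> Y -> Prop) : (forall n, negligible_family (F n)) ->
  exists F', negligible_family F' /\ forall n m y, F n m y -> exists k, F' k y.
Proof.
  intros H. exists (fun z => let (n, m) := Cantor.of_nat z in F n m). split.
  - intro z. destruct (Cantor.of_nat z); apply H.
  - intros n m y Hy. exists (Cantor.to_nat (n, m)). now rewrite Cantor.cancel_of_to.
Qed.

Definition killed (D : (nat -> nat) -> Prop) i (c : (nat -> nat) -> list bool -> Y) F : Prop :=
  forall a, D a -> exists s, length s = i /\ exists n : nat, F n (c a s).

Definition large D i c : Prop := forall F, negligible_family F -> ~ killed D i c F.

Lemma parametrization : exists (D : nat -> (nat -> nat) -> Prop) (f : nat -> (nat -> nat) -> Y * Y),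
  forall m, closed (D m) /\ continuous Baire (prodT Y Y) (f m) /\
    forall x y, Bm m x y <-> exists a, D m a /\ f m a = (x, y).
Proof.
  assert (Hi : inhabited Y).
  { apply NNPP; intro Hi. apply (uncovered (fun _ _ => False)).
    - intro n; split; [apply (borel_const Y)|intros x y []].
    - intro y; destruct Hi; now constructor. }
  assert (K : forall m, exists D f, closed D /\ continuous Baire (prodT Y Y) f /\
    forall x y, Bm m x y <-> exists a, D a /\ f a = (x, y)).
  { intro m. destruct (analytic_closed (prodT Y Y) (fun p => Bm m (fst p) (snd p))) as (D & f & H1 & H2 & H3);
      [|apply Bm_analytic|].
    - destruct Hi as [y]; exact (inhabits (y, y)).
    - exists D, f; split; [|split]; auto. intros x y; exact (H3 (x, y)). }
  apply choice in K as [D K]. apply choice in K as [f K]. exists D, f; exact K.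
Qed.

Section Construction.
Variable Dm : nat -> (nat -> nat) -> Prop.
Variable fm : nat -> (nat -> nat) -> Y * Y.
Hypothesis Dm_closed : forall m, closed (Dm m).
Hypothesis fm_continuous : forall m, continuous Baire (prodT Y Y) (fm m).
Hypothesis Bm_param : forall m x y, Bm m x y <-> exists a, Dm m a /\ fm m a = (x, y).

(** A state is a whole family of configurations indexed by Baire space: [conf S a s] is the vertex
    of the [a]-th one at the word [s]. When [s] and [t] form an edge, [wit S a s t] is its parameter
    in the closed set of its label, and [lab S j] is the label of the edges whose ends first differ
    at bit [j]. *)
Record state := { conf : (nat -> nat) -> list bool -> Y ;
  wit : (nat -> nat) -> list bool -> list bool -> nat -> nat ;
  lab : nat -> nat }.

Definition valid D i (S : state) : Prop :=
  (forall s, continuous Baire Y (fun a => conf S a s)) /\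
  (forall s t, continuous Baire Baire (fun a => wit S a s t)) /\
  (forall j k, j < k -> k < i -> lab S j < lab S k) /\
  (forall a j s t, D a -> edge i j s t ->
     Dm (lab S j) (wit S a s t) /\ fm (lab S j) (wit S a s t) = (conf S a s, conf S a t)) /\
  large D i (conf S).

Definition ix (b : bool) : nat := if b then 1 else 0.
(** A parameter of the doubled family packs two parameters of the old one, in columns 0 and 1, and a
    witness of the new edge, in column 2. The last bit of a word tells the copy. *)
Definition dconf S a s := conf S (col (ix (last s false)) a) (removelast s).
(** An old edge takes its witness from the copy of its source. If its target lies in the other copy,
    this is right because [splits] makes both copies of the target coincide. *)
Definition dwit S a s t := if list_eq_dec Bool.bool_dec (removelast s) (removelast t)
  then col 2 a else wit S (col (ix (last s false)) a) (removelast s) (removelast t).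
Definition ddom S v m a := Dm m (col 2 a) /\
  fm m (col 2 a) = (conf S (col 0 a) v, conf S (col 1 a) v).

Lemma dconf_snoc S a s b : dconf S a (s ++ [b]) = conf S (col (ix b) a) s.
Proof. unfold dconf. now rewrite last_last, removelast_last. Qed.

(** Suppose that for every [m >= b] a negligible family kills the doubled configurations, and let
    [F1] be the union of these families. The vertices at [v] of the old configurations avoiding [F1]
    form an analytic set [A] without edges of label at least [b], as such an edge would give a
    doubled configuration avoiding [F1]. So [A] is negligible, and together with [F1] it kills the
    old family. *)
Lemma doubling_large i S v b : valid (fun _ => True) i S -> length v = i ->
  exists m, b <= m /\ large (ddom S v m) (i + 1) (dconf S).
Proof.
  intros (Hc & Hw & Hl & He & HL) Hv. apply NNPP; intro Hno.
  assert (K : forall m, exists F, negligible_family F /\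
    (b <= m -> killed (ddom S v m) (i + 1) (dconf S) F)).
  { intro m. destruct (le_lt_dec b m) as [h|h].
    - apply NNPP; intro H; apply Hno. exists m; split; auto.
      intros F HF HK; apply H. eauto.
    - exists (fun _ _ => False). split; [|lia].
      intro n; split; [apply (borel_const Y)|intros x y []]. }
  apply choice in K as [F HF].
  destruct (negligible_countable F) as (F1 & HF1 & HFF1); [apply HF|].
  pose (N := fun a => exists s, In s (words i) /\ exists n, F1 n (conf S a s)).
  assert (Hemp : borel Baire (fun _ => False)) by (apply borel_open; intros a []).
  assert (HN : borel Baire N).
  { apply borel_list_exists; auto. intros s.
    apply (borel_cunion Baire (fun n a => F1 n (conf S a s))). intro n.
    apply (borel_preimage Baire Y (fun a => conf S a s)); [|apply HF1].
    now apply continuous_borel_fun. }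
  pose (A := fun y => exists a, ~ N a /\ conf S a v = y).
  assert (HA : analytic Y A).
  { apply (analytic_image Baire Y (fun a => conf S a v)); auto.
    apply (borel_analytic Baire N); auto using baire_hausdorff, baire_analytic. }
  destruct (tail_independent_negligible A b HA) as (F2 & HF2 & HAF2).
  { intros x y (a & Na & <-) (a' & Na' & <-) (m & Hm & HBm).
    apply Bm_param in HBm as (w & Dw & Ew).
    pose (u := fun n => match n with 0 => a | 1 => a' | _ => w end).
    destruct (proj2 (HF m) Hm (join u)) as (s & Hs & n & Hn).
    { unfold ddom. rewrite !col_join. cbn. auto. }
    rewrite Nat.add_1_r in Hs. destruct (snoc_cases s i Hs) as (s' & c & -> & Hs').
    rewrite dconf_snoc, col_join in Hn. apply HFF1 in Hn as [k Hk].
    assert (In s' (words i)) by (rewrite <- Hs'; apply in_words).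
    destruct c; cbn in Hk; [apply Na'|apply Na]; exists s'; eauto. }
  destruct (negligible_countable (fun n => match n with 0 => F1 | _ => F2 end)) as (F3 & HF3 & HFF3).
  { intros [|]; auto. }
  apply (HL F3 HF3). intros a _. destruct (classic (N a)) as [Na|Na].
  - destruct Na as (s & Hs & n & Hn). exists s. split; [|apply (HFF3 0 n _ Hn)].
    clear -Hs. revert s Hs. induction i as [|i IH]; cbn; intros s.
    + intros [<-|[]]; auto.
    + intros Hs; apply in_flat_map in Hs as (t & Ht & Hs). apply IH in Ht.
      destruct Hs as [<-|[<-|[]]]; rewrite length_app; cbn; lia.
  - destruct (HAF2 (conf S a v)) as [n Hn]; [exists a; auto|].
    exists v; split; auto. apply (HFF3 1 n _ Hn).
Qed.

Definition dstate i S m := {| conf := dconf S ; wit := dwit S ;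
  lab := fun j => if j <? i then lab S j else m |}.

Lemma dstate_valid i S v : valid (fun _ => True) i S -> splits i v ->
  exists m, valid (ddom S v m) (i + 1) (dstate i S m) /\ closed (ddom S v m) /\
    forall a x y, ddom S v m a -> code i x = code i y -> bit i x <> bit i y ->
      dconf S a (code (i + 1) x) <> dconf S a (code (i + 1) y).
Proof.
  intros HS Hv. destruct Hv as (Hlen & Hnew & Hforce).
  pose proof HS as (Hc & Hw & Hl & He & HL).
  (* [b] exceeds all labels in use, so any new label from [b] on keeps the labels increasing. *)
  destruct (finite_bound (fun j b => lab S j < b) i) as [b Hb]; [intros; lia|eauto|].
  destruct (doubling_large i S v b HS Hlen) as (m & Hbm & Hlarge).
  set (lab' := fun j => if j <? i then lab S j else m).
  assert (Hlab : forall j, j < i -> lab' j = lab S j).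
  { intros j Hj; unfold lab'. apply Nat.ltb_lt in Hj. now rewrite Hj. }
  assert (Hlabi : lab' i = m) by (unfold lab'; now rewrite Nat.ltb_irrefl).
  assert (Hmono : forall j k, j < k -> k <= i -> lab' j < lab' k).
  { intros j k Hjk Hk. rewrite Hlab by lia. destruct (Nat.eq_dec k i) as [->|].
    - rewrite Hlabi. specialize (Hb j Hjk). lia.
    - rewrite Hlab by lia. apply Hl; lia. }
  assert (Hlb : forall a, labelled i lab' (conf S a)).
  { intros a j s t Hst. apply Bm_param. exists (wit S a s t).
    assert (Hj : j < i) by (destruct Hst as (x & y & _ & Hj & _); auto).
    rewrite Hlab by auto. apply He; auto. }
  (* The consequences of [splits] for the copies given by columns 0 and 1; column 2 supplies the
     edge between their vertices at [v]. *)
  assert (Hfc : forall a, ddom S v m a -> _) by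
   (intros a Ha; exact (Hforce lab' _ _ Hmono (Hlb (col 0 a)) (Hlb (col 1 a))
      (eq_ind_r (fun k => Bm k _ _) (proj2 (Bm_param m _ _) (ex_intro _ (col 2 a) Ha)) Hlabi))).
  exists m; split; [|split].
  - split; [|split; [|split; [|split]]]; auto.
    + intro s. exact (continuous_comp Baire Baire Y _ _ (col_continuous _) (Hc _)).
    + intros s t; cbn; unfold dwit. destruct (list_eq_dec _ _ _); [apply col_continuous|].
      exact (continuous_comp Baire Baire Baire _ _ (col_continuous _) (Hw _ _)).
    + intros j k Hjk Hk. apply Hmono; lia.
    + intros a j s t Ha (x & y & Hxy & Hj & Hcode & Hbit & <- & <-).
      rewrite Nat.add_1_r in *. rewrite !code_S. cbn [conf wit lab dstate].
      rewrite !dconf_snoc. unfold dwit. rewrite !removelast_last, last_last.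
      change (if j <? i then lab S j else m) with (lab' j).
      destruct (list_eq_dec Bool.bool_dec (code i x) (code i y)) as [E|E].
      (* Ends with the same first [i] bits can only be joined by the new edge, from copy 0 of [v] to
         copy 1. *)
      * assert (j = i) as ->.
        { destruct (Nat.eq_dec j i); auto. destruct Hbit. apply (proj1 (code_eq i x y) E). lia. }
        destruct (Hnew x y Hxy E Hbit) as [Ev E0]. rewrite <- E, Ev, E0, Hlabi.
        rewrite E0 in Hbit. destruct (bit i y); [|congruence]. exact Ha.
      * assert (Hji : j < i).
        { destruct (Nat.eq_dec j i) as [->|]; [contradiction|lia]. }
        rewrite Hlab by auto.
        assert (Ee : edge i j (code i x) (code i y)) by (exists x, y; auto 6).
        destruct (He (col (ix (bit i x)) a) j _ _ I Ee) as [K1 K2]. split; auto.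
        rewrite K2. f_equal. destruct (Bool.bool_dec (bit i x) (bit i y)) as [Eb|Eb]; [now rewrite Eb|].
        pose proof (proj1 (Hfc a Ha) x y Hxy E Eb) as K.
        destruct (bit i x), (bit i y); cbn; auto.
  - apply closed_and.
    + apply closed_preimage; auto using col_continuous.
    + apply (closed_eq (prodT Y Y)); [apply prod_hausdorff| |].
      * exact (continuous_comp Baire Baire (prodT Y Y) _ _ (col_continuous 2) (fm_continuous m)).
      * apply pair_continuous.
        -- exact (continuous_comp Baire Baire Y _ _ (col_continuous 0) (Hc v)).
        -- exact (continuous_comp Baire Baire Y _ _ (col_continuous 1) (Hc v)).
  - intros a x y Ha E Eb. rewrite Nat.add_1_r, !code_S, !dconf_snoc, <- E.
    pose proof (proj2 (Hfc a Ha) x y E Eb).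
    destruct (bit i x), (bit i y); cbn; auto; congruence.
Qed.
Lemma large_retract D i c r : large D i c -> (forall a, D a -> r a = a) ->
  large (fun _ => True) i (fun a => c (r a)).
Proof.
  intros HL Hr F HF HK. apply (HL F HF). intros a Da.
  destruct (HK a I) as (s & Hs & n & Hn). rewrite Hr in Hn by auto. eauto.
Qed.

(** There are only countably many finite sequences: if for each good prefix a negligible family
    killed the restricted configurations, the union of these families would kill all of them, since
    every parameter has a good prefix. *)
Lemma large_shift i c (good : list nat -> Prop) : large (fun _ => True) i c ->
  (forall a, exists k, good (prefix k a)) ->
  exists s, good s /\ large (fun _ => True) i (fun a => c (shift_in s a)).
Proof.
  intros HL Hgood. apply NNPP; intro Hno.
  assert (K : forall s, exists F, negligible_family F /\
    (good s -> killed (fun _ => True) i (fun a => c (shift_in s a)) F)).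
  { intro s. destruct (classic (good s)) as [Hs|Hs].
    - apply NNPP; intro H; apply Hno. exists s; split; auto.
      intros F HF HK; apply H. eauto.
    - exists (fun _ _ => False). split; [|tauto].
      intro n; split; [apply (borel_const Y)|intros x y []]. }
  apply choice in K as [F HF].
  destruct (negligible_countable (fun z => let (l, n) := Cantor.of_nat z in F (seq_code l n)))
    as (F' & HF' & HFF').
  { intro z. destruct (Cantor.of_nat z). apply HF. }
  apply (HL F' HF'). intros a _. destruct (Hgood a) as [k Hk].
  destruct (starts_shift_in (prefix k a) a) as [b Hb]; [now apply starts_prefix|].
  destruct (proj2 (HF _) Hk b I) as (s & Hs & n & Hn). rewrite <- Hb in Hn.
  exists s; split; auto.
  destruct (seq_code_surj (prefix k a)) as [p Hp].
  apply (HFF' (Cantor.to_nat (length (prefix k a), p)) n). rewrite Cantor.cancel_of_to.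
  now rewrite Hp.
Qed.

(** Each configuration of [S'] consists of two configurations of [S], and vertices and witnesses
    vary little with the parameter. The last clause demands a uniform gap [e] because mere
    distinctness would not survive in the limit. *)
Definition refines i (S S' : state) : Prop :=
  (forall j, j < i -> lab S' j = lab S j) /\
  (forall a, exists u : bool -> nat -> nat,
    (forall s b, conf S' a (s ++ [b]) = conf S (u b) s) /\
    (forall s t b c, s <> t -> wit S' a (s ++ [b]) (t ++ [c]) = wit S (u b) s t)) /\
  (forall a a' s, length s = i + 1 -> (d (conf S' a s) (conf S' a' s) < (1/2)^i)%R) /\
  (forall a a' s t, length s = i + 1 -> length t = i + 1 -> agree i (wit S' a s t) (wit S' a' s t)) /\
  (forall x y, code i x = code i y -> bit i x <> bit i y -> exists e, (0 < e)%R /\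
    forall a a', (e <= d (conf S' a (code (i + 1) x)) (conf S' a' (code (i + 1) y)))%R).

(** Doubling leaves a closed set of parameters. A retraction makes Baire space the domain again, and
    restricting to a long common prefix makes diameters small and gaps uniform. *)
Lemma refinement i S : valid (fun _ => True) i S ->
  exists S', valid (fun _ => True) (i + 1) S' /\ refines i S S'.
Proof.
  intros HS. destruct (splits_ex i) as [v Hv].
  destruct (dstate_valid i S v HS Hv) as (m & (Hc & Hw & Hl & He & HL) & HD & Hsep).
  assert (Hne : exists a, ddom S v m a).
  { apply NNPP; intro H. apply (HL (fun _ _ => False)).
    - intro n; split; [apply (borel_const Y)|intros x y []].
    - intros a Da; destruct H; eauto. }
  destruct (closed_retract _ HD Hne) as (r & Hr & HrD & Hrid).
  set (T := dstate i S m) in *.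
  assert (Hc' : forall s, continuous Baire Y (fun a => conf T (r a) s)).
  { intro s. exact (continuous_comp Baire Baire Y r _ Hr (Hc s)). }
  assert (Hw' : forall s t, continuous Baire Baire (fun a => wit T (r a) s t)).
  { intros s t. exact (continuous_comp Baire Baire Baire r _ Hr (Hw s t)). }
  pose (small := fun (P : (nat -> nat) -> Prop) s t => forall a a', P a -> P a' ->
    (d (conf T (r a) s) (conf T (r a') s) < (1/2)^i)%R /\
    agree i (wit T (r a) s t) (wit T (r a') s t)).
  pose (apart := fun (P : (nat -> nat) -> Prop) s t =>
    (exists x y, code i x = code i y /\ bit i x <> bit i y /\ code (i + 1) x = s /\ code (i + 1) y = t) ->
    exists e, (0 < e)%R /\ forall a a', P a -> P a' -> (e <= d (conf T (r a) s) (conf T (r a') t))%R).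
  destruct (large_shift (i + 1) (fun a => conf T (r a))
    (fun l => forall p, In p (list_prod (words (i + 1)) (words (i + 1))) ->
       small (starts l) (fst p) (snd p) /\ apart (starts l) (fst p) (snd p))) as (l & Hgood & HlL).
  { apply (large_retract (ddom S v m)); auto. }
  { intros a0.
    destruct (list_bound (list_prod (words (i + 1)) (words (i + 1)))
      (fun p k => small (fun a => agree k a a0) (fst p) (snd p) /\
                  apart (fun a => agree k a a0) (fst p) (snd p))) as [k Hk].
    - intros [s t] k k' Hk [H1 H2]; split.
      + intros a a' Ha Ha'. apply H1; eapply agree_le; eauto.
      + intros Hx. destruct (H2 Hx) as (e & He0 & H). exists e; split; auto.
        intros a a' Ha Ha'. apply H; eapply agree_le; eauto.
    - intros [s t] _; cbn [fst snd].
      destruct (proj1 (continuous_dist Y _) (Hc' s) a0 ((1/2)^i / 2)%R) as [k1 Hk1].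
      { pose proof (half_pow_pos i); lra. }
      destruct (baire_continuous_agree _ (Hw' s t) a0 i) as [k2 Hk2].
      assert (Hap : exists k, apart (fun a => agree k a a0) s t).
      { destruct (classic (exists x y, code i x = code i y /\ bit i x <> bit i y /\
          code (i + 1) x = s /\ code (i + 1) y = t)) as [Hx|Hx].
        2: exists 0; intro; contradiction.
        assert (Hst : conf T (r a0) s <> conf T (r a0) t).
        { destruct Hx as (x & y & E & Eb & <- & <-). apply Hsep; auto. }
        apply dist_pos in Hst.
        set (e := d (conf T (r a0) s) (conf T (r a0) t)) in *.
        destruct (proj1 (continuous_dist Y _) (Hc' s) a0 (e / 4)%R) as [k3 Hk3]; [lra|].
        destruct (proj1 (continuous_dist Y _) (Hc' t) a0 (e / 4)%R) as [k4 Hk4]; [lra|].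
        exists (max k3 k4). intros _. exists (e / 2)%R; split; [lra|].
        intros a a' Ha Ha'.
        specialize (Hk3 a (agree_le _ _ _ _ (Nat.le_max_l _ _) Ha)).
        specialize (Hk4 a' (agree_le _ _ _ _ (Nat.le_max_r _ _) Ha')).
        pose proof (P_dist_tri Y (conf T (r a0) s) (conf T (r a) s) (conf T (r a0) t)).
        pose proof (P_dist_tri Y (conf T (r a) s) (conf T (r a') t) (conf T (r a0) t)).
        rewrite (P_dist_sym Y (conf T (r a') t)) in H0. fold e in H. lra. }
      destruct Hap as [k5 Hk5]. exists (max k5 (max k1 k2)). split.
      + intros a a' Ha Ha'.
        assert (H1 : agree k1 a a0) by (eapply agree_le; [|exact Ha]; lia).
        assert (H2 : agree k1 a' a0) by (eapply agree_le; [|exact Ha']; lia).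
        split.
        * apply Hk1 in H1, H2.
          pose proof (P_dist_tri Y (conf T (r a) s) (conf T (r a0) s) (conf T (r a') s)).
          rewrite (P_dist_sym Y (conf T (r a) s) (conf T (r a0) s)) in H. lra.
        * apply agree_trans with (wit T (r a0) s t); [|apply agree_sym]; apply Hk2;
            [eapply agree_le; [|exact Ha]|eapply agree_le; [|exact Ha']]; lia.
      + intros Hx. destruct (Hk5 Hx) as (e & He0 & H). exists e; split; auto.
        intros a a' Ha Ha'.
        apply H; [eapply agree_le; [|exact Ha]|eapply agree_le; [|exact Ha']]; lia.
    - exists k. intros p Hp. destruct (Hk p Hp) as [H1 H2]. split.
      + intros a a' Ha Ha'. apply H1; now apply starts_prefix.
      + intros Hx. destruct (H2 Hx) as (e & He0 & H). exists e; split; auto.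
        intros a a' Ha Ha'. apply H; now apply starts_prefix. }
  assert (Hin : forall s, length s = i + 1 -> In s (words (i + 1))).
  { intros s <-. apply in_words. }
  exists {| conf := fun a => conf T (r (shift_in l a)); wit := fun a => wit T (r (shift_in l a));
            lab := lab T |}.
  split.
  - split; [|split; [|split; [|split]]]; cbn [conf wit lab]; auto.
    + intro s. exact (continuous_comp Baire Baire Y _ _ (shift_in_continuous l) (Hc' s)).
    + intros s t. exact (continuous_comp Baire Baire Baire _ _ (shift_in_continuous l) (Hw' s t)).
  - split; [|split; [|split; [|split]]]; cbn [conf wit lab].
    + intros j Hj. unfold T, dstate; cbn [lab]. apply Nat.ltb_lt in Hj. now rewrite Hj.
    + intros a. exists (fun b => col (ix b) (r (shift_in l a))). split.
      * intros s b. apply dconf_snoc.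
      * intros s t b c Hst. cbn. unfold dwit. rewrite !removelast_last, last_last.
        destruct (list_eq_dec _ _ _); [contradiction|auto].
    + intros a a' s Hs. refine (proj1 (proj1 (Hgood (s, s) _) _ _ _ _));
        auto using shift_in_starts, in_prod.
    + intros a a' s t Hs Ht. refine (proj2 (proj1 (Hgood (s, t) _) _ _ _ _));
        auto using shift_in_starts, in_prod.
    + intros x y E Eb.
      destruct (Hgood (code (i + 1) x, code (i + 1) y)) as [_ H].
      { apply in_prod; apply Hin, code_length. }
      destruct H as (e & He0 & H); [exists x, y; auto|].
      exists e; split; auto. intros a a'. apply H; apply shift_in_starts.
Qed.
Lemma initial_state : exists S, valid (fun _ => True) 0 S.
Proof.
  destruct (polish_analytic Y) as [HY|(f & Hf & Hfs)].
  { exfalso. apply (uncovered (fun _ _ => False)).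
    - intro n; split; [apply (borel_const Y)|intros x y []].
    - intro y; destruct (HY y I). }
  exists {| conf := fun a _ => f a; wit := fun a _ _ => a; lab := fun n => n |}.
  split; [|split; [|split; [|split]]]; cbn; auto.
  - intros _ _. intros V HV; exact HV.
  - intros a j s t _ (x & y & _ & Hj & _). lia.
  - intros F HF HK. apply (uncovered F HF). intro y.
    destruct (proj1 (Hfs y) I) as [a <-]. destruct (HK a I) as (s & _ & H); auto.
Qed.

Lemma refining_sequence : exists st : nat -> state,
  (forall i, valid (fun _ => True) i (st i)) /\ forall i, refines i (st i) (st (i + 1)).
Proof.
  destruct initial_state as [S0 H0].
  assert (K : forall p : {iS : nat * state | valid (fun _ => True) (fst iS) (snd iS)},
    exists p' : {iS : nat * state | valid (fun _ => True) (fst iS) (snd iS)},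
      fst (proj1_sig p') = fst (proj1_sig p) + 1 /\
      refines (fst (proj1_sig p)) (snd (proj1_sig p)) (snd (proj1_sig p'))).
  { intros [[i S] HS]; cbn in *. destruct (refinement i S HS) as (S' & HS' & HR).
    exists (exist _ (i + 1, S') HS'); auto. }
  apply choice in K as [next Hnext].
  pose (seq := fix seq (n : nat) : {iS : nat * state | valid (fun _ => True) (fst iS) (snd iS)} :=
    match n with 0 => exist _ (0, S0) H0 | S n => next (seq n) end).
  assert (Hfst : forall n, fst (proj1_sig (seq n)) = n).
  { induction n as [|n IH]; auto. change (seq (S n)) with (next (seq n)).
    rewrite (proj1 (Hnext _)), IH. lia. }
  exists (fun n => snd (proj1_sig (seq n))). split.
  - intro n. rewrite <- (Hfst n) at 1. apply (proj2_sig (seq n)).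
  - intro n. rewrite <- (Hfst n) at 1. rewrite Nat.add_1_r. exact (proj2 (Hnext (seq n))).
Qed.

Lemma fusion_limit : exists h : pt Cantor -> pt Y, injective h /\ continuous Cantor Y h /\
  forall x y, G x y -> exists m, Bm m (h x) (h y).
Proof.
  destruct refining_sequence as (st & Hval & Href).
  (* Any parameter would do: by [Hconf], a vertex of a later stage is a vertex of each earlier stage
     under some parameter, and the bounds of [refines] hold for all parameters. *)
  pose (z := fun _ : nat => 0).
  pose (u := fun i x => conf (st i) z (code i x)).
  assert (Hconf : forall i j x a, i <= j -> exists a',
    conf (st j) a (code j x) = conf (st i) a' (code i x)).
  { intros i j x a Hij. revert a. induction Hij as [|j Hij IH]; intro a; [eauto|].
    destruct (Href j) as (_ & H & _). destruct (H a) as (c & H1 & _).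
    rewrite Nat.add_1_r in H1. rewrite code_S, H1. apply IH. }
  assert (Hwit : forall i j x y a, i <= j -> code i x <> code i y -> exists a',
    wit (st j) a (code j x) (code j y) = wit (st i) a' (code i x) (code i y)).
  { intros i j x y a Hij E. revert a. induction Hij as [|j Hij IH]; intro a; [eauto|].
    destruct (Href j) as (_ & H & _). destruct (H a) as (c & _ & H2).
    rewrite Nat.add_1_r in H2. rewrite !code_S, H2; [apply IH|].
    intro E'; apply E. apply code_eq. intros k Hk. apply (proj1 (code_eq j x y) E'). lia. }
  assert (Hlab : forall i j, i < j -> lab (st j) i = lab (st (S i)) i).
  { intros i j Hij. induction Hij as [|j Hij IH]; auto.
    destruct (Href j) as (H & _). rewrite Nat.add_1_r in H. rewrite H; auto. }
  assert (L : forall x, exists l, forall n, (d (u (S n) x) l <= 1 * (1/2)^n)%R).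
  { intro x. apply geometric_limit; [lra|]. intros n m Hnm. unfold u.
    destruct (Hconf (S n) (S m) x z) as [a' ->]; [lia|].
    destruct (Href n) as (_ & _ & H & _). rewrite Nat.add_1_r in H.
    specialize (H z a' (code (S n) x) (code_length _ _)). lra. }
  apply choice in L as [h Hh].
  assert (Hu : forall x eps, (0 < eps)%R -> exists N, forall n, N <= n -> (d (u n x) (h x) < eps)%R).
  { intros x eps He. destruct (half_pow_small eps He) as [N HN]. exists (S N).
    intros [|n] Hn; [lia|]. specialize (Hh x n).
    pose proof (half_pow_le N n ltac:(lia)). lra. }
  exists h. split; [|split].
  - intros x y Hxy. apply bit_injective. intro j.
    induction j as [j IH] using (well_founded_induction lt_wf).
    destruct (Bool.bool_dec (bit j x) (bit j y)) as [|Hb]; auto. exfalso.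
    (* At the first bit where [x] and [y] differ, [refines] leaves a gap that all later stages
       respect. *)
    destruct (Href j) as (_ & _ & _ & _ & H).
    destruct (H x y) as (e & He & Hsep); [apply code_eq; auto|auto|]. rewrite Nat.add_1_r in Hsep.
    destruct (Hu x (e / 2)%R) as [n Hn]; [lra|]. destruct (Hu y (e / 2)%R) as [m Hm]; [lra|].
    set (k := max (S j) (max n m)).
    specialize (Hn k ltac:(lia)). specialize (Hm k ltac:(lia)). unfold u in Hn, Hm.
    destruct (Hconf (S j) k x z) as [a Ea]; [lia|]. destruct (Hconf (S j) k y z) as [b Eb]; [lia|].
    rewrite Ea in Hn. rewrite Eb in Hm. specialize (Hsep a b).
    rewrite Hxy in Hn.
    pose proof (P_dist_tri Y (conf (st (S j)) a (code (S j) x)) (h y) (conf (st (S j)) b (code (S j) y))).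
    rewrite (P_dist_sym Y (h y)) in H0. lra.
  - intros V HV x Vx. destruct (HV _ Vx) as (e & He & HVe).
    destruct (half_pow_small (e/2)) as [n Hn]; [lra|].
    destruct (finite_bound (fun j m => forall y, agree m y x -> bit j y = bit j x) (S n)) as [m Hm].
    { intros j m m' Hle H y Hy. apply H. eapply agree_le; eauto. }
    { intros j _. apply bit_continuous. }
    exists m. intros y Hy. apply HVe.
    assert (E : u (S n) y = u (S n) x).
    { unfold u. f_equal. apply code_eq. intros j Hj. now apply Hm. }
    pose proof (Hh x n). pose proof (Hh y n). rewrite E in H0.
    pose proof (P_dist_tri Y (h x) (u (S n) x) (h y)). rewrite (P_dist_sym Y (h x) (u (S n) x)) in H1. lra.
  - intros x y Hxy.
    assert (Hj : exists j, code j x = code j y /\ bit j x <> bit j y).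
    { apply NNPP; intro Hno. apply (G_irrefl x).
      replace y with x in Hxy; auto. apply bit_injective. intro j.
      induction j as [j IH] using (well_founded_induction lt_wf).
      destruct (Bool.bool_dec (bit j x) (bit j y)) as [|Hb]; auto. destruct Hno.
      exists j; split; auto. now apply code_eq. }
    destruct Hj as (j & E & Eb). set (m := lab (st (S j)) j). exists m.
    pose (W := fun i => wit (st i) z (code i x) (code i y)).
    assert (HW : forall i, j < i -> Dm m (W i) /\ fm m (W i) = (u i x, u i y)).
    { intros i Hi. destruct (Hval i) as (_ & _ & _ & H & _). unfold m. rewrite <- (Hlab j i Hi).
      apply H; auto. exists x, y; auto 6. }
    assert (Hne : forall i, j < i -> code i x <> code i y).
    { intros i Hi Ei. apply Eb. apply (proj1 (code_eq i x y) Ei j Hi). }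
    assert (Hagree : forall i i', j < i + 1 -> i + 1 <= i' -> agree i (W i') (W (i + 1))).
    { intros i i' Hi Hi'. unfold W. destruct (Hwit (i + 1) i' x y z Hi') as [a' ->]; [apply Hne; lia|].
      destruct (Href i) as (_ & _ & _ & H & _). apply H; apply code_length. }
    (* The witnesses from stage [k + j + 2] on agree on their first [k + j + 1] entries, so entry
       [k] of the limit can be read off there. *)
    pose (w := fun k => W (k + j + 1 + 1) k).
    assert (Hw : forall n i, n + j + 2 <= i -> agree n (W i) w).
    { intros n i Hi k Hk. unfold w. apply (Hagree (k + j + 1)); lia. }
    (* Closedness keeps the limit of the witnesses in the domain, and continuity sends it to the
       pair of limits. *)
    apply Bm_param. exists w. split.
    + apply NNPP; intro Hno. destruct (Dm_closed m w Hno) as [n Hn].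
      apply (Hn (W (n + j + 2))); [apply Hw; lia|apply HW; lia].
    + assert (Hlim : forall (f : Y * Y -> Y) (p : nat -> bool), continuous (prodT Y Y) Y f ->
        (forall i, j < i -> f (u i x, u i y) = u i p) -> f (fm m w) = h p).
      { intros f p Hf Hfu. apply (P_dist_eq0 Y). apply Rle_antisym; [|apply P_dist_nonneg].
        apply Rle_plus_epsilon. intros eps He.
        destruct (proj1 (continuous_dist Y (fun a => f (fm m a)))
          (continuous_comp Baire (prodT Y Y) Y _ f (fm_continuous m) Hf) w (eps / 2)%R) as [n Hn]; [lra|].
        destruct (Hu p (eps / 2)%R) as [k Hk]; [lra|].
        set (i := max (n + j + 2) k).
        specialize (Hn (W i) (Hw n i ltac:(lia))). specialize (Hk i ltac:(lia)).
        rewrite (proj2 (HW i ltac:(lia))), Hfu in Hn by lia.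
        pose proof (P_dist_tri Y (f (fm m w)) (u i p) (h p)). lra. }
      rewrite (surjective_pairing (fm m w)). f_equal.
      * apply Hlim; [apply fst_continuous|auto].
      * apply Hlim; [apply snd_continuous|auto].
Qed.
End Construction.

Theorem fusion : exists h : pt Cantor -> pt Y, injective h /\ continuous Cantor Y h /\
  forall x y, G x y -> exists m, Bm m (h x) (h y).
Proof.
  destruct parametrization as (D & f & H). apply (fusion_limit D f); apply H.
Qed.
End Fusion.

(** * Digraphs below a union of graphs *)

Lemma bool_eq_iff (b c : bool) : b = true /\ c = true \/ ~ b = true /\ ~ c = true <-> b = c.
Proof. destruct b, c; intuition congruence. Qed.

Lemma least_element (P : nat -> Prop) : (exists n, P n) -> exists n, P n /\ forall m, m < n -> ~ P m.
Proof.
  intros [n Hn]. induction n as [n IH] using (well_founded_induction lt_wf).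
  destruct (classic (exists m, m < n /\ P m)) as [(m & Hm & Pm)|H]; [eauto|].
  exists n; split; auto. intros m Hm Pm; eauto.
Qed.

Lemma countable_chromatic_of_cover (Y : Polish) (R : Y -> Y -> Prop) (F : nat -> Y -> Prop) :
  (forall n, borel Y (F n) /\ independent R (F n)) -> (forall y, exists n, F n y) ->
  countable_borel_chromatic Y R.
Proof.
  intros HF Hcov.
  assert (K := fun y => least_element (fun n => F n y) (Hcov y)).
  apply choice in K as [c Hc]. exists c. split.
  - intros V _.
    apply borel_ext with (fun y => exists n, V n /\ (F n y /\ forall m, m < n -> ~ F m y)).
    + intro y; split.
      * intros (n & Vn & Fn & Hmin). destruct (Hc y) as [H1 H2].
        destruct (lt_eq_lt_dec n (c y)) as [[h| ->]|h]; auto.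
        -- destruct (H2 n h Fn).
        -- destruct (Hmin _ h H1).
      * intros Vc. exists (c y); split; auto; apply Hc.
    + apply (borel_cunion Y). intro n. apply (borel_and Y); [apply (borel_const Y)|].
      apply (borel_and Y); [apply HF|]. apply (borel_cinter Y). intro m.
      destruct (lt_dec m n) as [h|h].
      * apply borel_ext with (fun y => ~ F m y); [tauto|]. apply (borel_compl Y), HF.
      * apply borel_ext with (fun _ => True); [tauto|]. apply (borel_const Y).
  - intros x y Hxy E. apply (proj2 (HF (c x)) x y); auto; [apply Hc|]. rewrite E; apply Hc.
Qed.

(* Both [G0] and [G1] are unions of graphs of continuous maps defined on basic clopen sets. *)
Definition graph_of (t : nat -> list bool) (f : nat -> (nat -> bool) -> nat -> bool)
  (x y : nat -> bool) : Prop := exists n, extends (t n ++ [false]) x /\ forall k, y k = f n x k.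

Lemma extends_snoc s b x : extends (s ++ [b]) x <-> extends s x /\ x (length s) = b.
Proof.
  unfold extends. rewrite length_app; cbn. split.
  - intros H; split.
    + intros k Hk. rewrite H by lia. now rewrite app_nth1.
    + rewrite H by lia. rewrite app_nth2, Nat.sub_diag by lia. auto.
  - intros [H1 H2] k Hk. destruct (Nat.eq_dec k (length s)) as [->|].
    + rewrite app_nth2, Nat.sub_diag by lia. auto.
    + rewrite app_nth1 by lia. apply H1; lia.
Qed.

Lemma extends_agree s x y n : length s <= n -> agree n y x -> extends s x -> extends s y.
Proof. intros Hn Hy Hx k Hk. rewrite Hy by lia. now apply Hx. Qed.

Section Target.
Variables (t : nat -> list bool) (f : nat -> (nat -> bool) -> nat -> bool).
Hypothesis f_continuous : forall n x k, exists N, forall y, agree N y x -> f n y k = f n x k.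
Hypothesis f_flip : forall n x, extends (t n ++ [false]) x -> f n x (length (t n)) = true.
Variable bit : nat -> (nat -> bool) -> bool.
Hypothesis bit_continuous : forall j x, exists n, forall y, agree n y x -> bit j y = bit j x.
Hypothesis bit_injective : forall x y, (forall j, bit j x = bit j y) -> x = y.

Lemma graph_of_irrefl x : ~ graph_of t f x x.
Proof.
  intros (n & Hx & E). pose proof (f_flip n x Hx) as H. rewrite <- E in H.
  apply extends_snoc in Hx as [_ Hx]. congruence.
Qed.

Variables (Y : Polish) (B : Y -> Y -> Prop) (h : Y -> nat -> bool).
Hypothesis HB : analytic_rel Y B.
Hypothesis HBc : ~ countable_borel_chromatic Y B.
Hypothesis h_borel : borel_fun Y Cantor h.
Hypothesis h_hom : forall x y, B x y -> graph_of t f (h x) (h y).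

Definition part m x y : Prop :=
  B x y /\ extends (t m ++ [false]) (h x) /\ forall k, h y k = f m (h x) k.

Hypothesis splits_ex : forall i, exists v, splits Y part (graph_of t f) bit i v.

Lemma part_analytic m : analytic_rel Y (part m).
Proof.
  unfold analytic_rel, part. apply analytic_and; [apply prod_hausdorff|exact HB|].
  apply prod_borel_analytic. apply borel_and.
  - apply (borel_preimage (prodT Y Y) Y fst (fun x => extends (t m ++ [false]) (h x))).
    + apply continuous_borel_fun, fst_continuous.
    + apply (h_borel (fun x => extends (t m ++ [false]) x)). intros x Hx.
      exists (length (t m ++ [false])). intros y Hy. eapply extends_agree; eauto.
  - apply borel_cinter. intro k.
    assert (H1 : borel (prodT Y Y) (fun p => h (snd p) k = true)).
    { apply (borel_preimage (prodT Y Y) Y snd (fun y => h y k = true)).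
      + apply continuous_borel_fun, snd_continuous.
      + apply (h_borel (fun x => x k = true)). intros x Hx. exists (S k). intros y Hy.
        now rewrite Hy by lia. }
    assert (H2 : borel (prodT Y Y) (fun p => f m (h (fst p)) k = true)).
    { apply (borel_preimage (prodT Y Y) Y fst (fun y => f m (h y) k = true)).
      + apply continuous_borel_fun, fst_continuous.
      + apply (h_borel (fun x => f m x k = true)). intros x Hx.
        destruct (f_continuous m x k) as [N HN]. exists N. intros y Hy. rewrite HN; auto. }
    apply borel_ext with (fun p => h (snd p) k = true /\ f m (h (fst p)) k = true \/
      ~ h (snd p) k = true /\ ~ f m (h (fst p)) k = true).
    + intro p. apply bool_eq_iff.
    + apply borel_or; apply borel_and; auto using borel_compl.
Qed.

Theorem embeds_below : exists k : pt Cantor -> pt Y, injective k /\ continuous Cantor Y k /\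
  forall x y, graph_of t f x y -> B (k x) (k y).
Proof.
  (* The cut of label [m] is the coordinate at which [t m ++ [false]] ends: false at the source of
     an edge with that label, true at its target. *)
  destruct (fusion Y part (fun m y => h y (length (t m)) = true) (graph_of t f) bit)
    as (k & H1 & H2 & H3); auto.
  - apply part_analytic.
  - intro m. apply (h_borel (fun x => x (length (t m)) = true)). intros x Hx.
    exists (S (length (t m))). intros y Hy. now rewrite Hy by lia.
  - intros m x y (_ & Hx & E). split; [|rewrite E; auto].
    apply extends_snoc in Hx as [_ Hx]. congruence.
  - intros F HF Hcov. apply HBc, (countable_chromatic_of_cover Y B F); auto.
    intro n; split; [apply HF|]. intros x y Fx Fy Hxy. apply (proj2 (HF n) x y Fx Fy).
    destruct (h_hom x y Hxy) as (m & Hm). exists m; split; auto.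
  - apply graph_of_irrefl.
  - exists k; split; [|split]; auto. intros x y Hxy. destruct (H3 x y Hxy) as (m & Hm & _); auto.
Qed.
End Target.

(** * Recoding an absorbing family of maps as a sequence of doublings *)

Definition decide (P : Prop) : bool := if excluded_middle_informative P then true else false.

Lemma decide_true P : decide P = true <-> P.
Proof. unfold decide. destruct (excluded_middle_informative P); intuition congruence. Qed.

Lemma decide_iff P Q : (P <-> Q) -> decide P = decide Q.
Proof.
  intro H. destruct (decide Q) eqn:E.
  - apply decide_true. apply H. now apply decide_true.
  - destruct (decide P) eqn:E'; auto. rewrite <- E. symmetry. apply decide_true, H. now apply decide_true.
Qed.

(** The first coordinate is the most significant digit, so comparing these numbers is
    lexicographic. *)
Fixpoint num (n : nat) (x : nat -> bool) : nat :=
  match n with 0 => 0 | S n => 2 * num n x + Nat.b2n (x n) end.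

Lemma num_bound n x : num n x < 2 ^ n.
Proof. induction n as [|n IH]; cbn [num Nat.pow]; [lia|]. destruct (x n); cbn [Nat.b2n]; lia. Qed.

Lemma num_agree n x y : num n x = num n y <-> agree n x y.
Proof.
  induction n as [|n IH]; [split; [intros _ k Hk; lia|reflexivity]|]. cbn [num]. split.
  - intros H. assert (E : num n x = num n y /\ x n = y n).
    { destruct (x n), (y n); cbn [Nat.b2n] in H; split; auto; lia. }
    destruct E as [E1 E2]. apply IH in E1. intros k Hk.
    destruct (Nat.eq_dec k n) as [->|]; auto. apply E1; lia.
  - intros H. rewrite (H n) by lia. rewrite (proj2 IH); auto. apply (agree_le n (S n)); auto.
Qed.

Lemma num_lt n k x y : k < n -> agree k x y -> x k = false -> y k = true -> num n x < num n y.
Proof.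
  intros Hk Hxy Hx Hy. induction Hk as [|n Hk IH]; cbn [num].
  - rewrite (proj2 (num_agree k x y)), Hx, Hy by auto. cbn; lia.
  - destruct (x n), (y n); cbn [Nat.b2n]; lia.
Qed.

Lemma code_difference bit i x y : code bit i x <> code bit i y ->
  exists j, j < i /\ code bit j x = code bit j y /\ bit j x <> bit j y.
Proof.
  induction i as [|i IH]; [intros []; reflexivity|]. intros H.
  destruct (list_eq_dec Bool.bool_dec (code bit i x) (code bit i y)) as [E|E].
  - exists i; split; [|split]; auto. intro Eb. apply H. now rewrite !code_S, E, Eb.
  - destruct (IH E) as (j & Hj & K); exists j; split; auto.
Qed.

Section Absorbing.
Variables (t : nat -> list bool) (f : nat -> (nat -> bool) -> nat -> bool).
Local Notation p n := (length (t n)).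
Local Notation dom n := (extends (t n ++ [false])).
Hypothesis p_incr : forall m n, m < n -> p m < p n.
Hypothesis f_below : forall n x k, k < p n -> f n x k = x k.
Hypothesis f_flip : forall n x, f n x (p n) = true.
Hypothesis f_continuous : forall n x k, exists N, forall y, agree N y x -> f n y k = f n x k.
Hypothesis f_absorb : forall m n x, m < n -> f m (f n x) = f m x.

Lemma p_inj m n : p m = p n -> m = n.
Proof.
  intro H. destruct (lt_eq_lt_dec m n) as [[h|h]|h]; auto; apply p_incr in h; lia.
Qed.

Lemma dom_agree n x y : agree (S (p n)) y x -> dom n x -> dom n y.
Proof. intros H. apply (extends_agree _ _ _ (S (p n))); auto. rewrite length_app; cbn; lia. Qed.

Lemma dom_bit n x : dom n x -> x (p n) = false.
Proof. intro H. now apply extends_snoc in H. Qed.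

Lemma f_agree n x : agree (p n) (f n x) x.
Proof. intros k Hk. now apply f_below. Qed.

Lemma dom_f m n x : m < n -> (dom m (f n x) <-> dom m x).
Proof.
  intro H. apply p_incr in H. split; apply dom_agree; [apply agree_sym|];
    apply (agree_le _ (p n)); auto using f_agree.
Qed.

(** Following the edge of largest index loses no other out-neighbour: by absorption, the edges of
    smaller index lead to the same points before and after the move. *)
Fixpoint top_edge (n : nat) (x : nat -> bool) : nat -> bool := match n with
  | 0 => x
  | S n => if excluded_middle_informative (dom n x) then f n x else top_edge n x end.

Lemma top_edge_cases n x :
  top_edge n x = x /\ (forall m, m < n -> ~ dom m x) \/
  exists M, M < n /\ dom M x /\ top_edge n x = f M x /\ forall m, m < n -> dom m x -> m <= M.
Proof.
  induction n as [|n IH]; cbn; [left; split; [auto|lia]|].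
  destruct (excluded_middle_informative (dom n x)) as [H|H].
  - right; exists n; repeat split; auto; lia.
  - destruct IH as [[E K]|(M & HM & HMx & E & K)].
    + left; split; auto. intros m Hm. destruct (Nat.eq_dec m n) as [->|]; auto. apply K; lia.
    + right; exists M; repeat split; auto. intros m Hm Hx.
      destruct (Nat.eq_dec m n) as [->|]; [contradiction|]. apply K; auto; lia.
Qed.

Fixpoint cnt (l : nat) : nat := match l with
  | 0 => 0
  | S l => if p (cnt l) =? l then S (cnt l) else cnt l end.

Lemma cnt_spec l m : m < cnt l <-> p m < l.
Proof.
  revert m; induction l as [|l IH]; intro m; cbn [cnt]; [lia|].
  assert (Hc : l <= p (cnt l)) by (pose proof (IH (cnt l)); lia).
  specialize (IH m). destruct (Nat.eqb_spec (p (cnt l)) l) as [E|E].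
  - destruct (Nat.eq_dec m (cnt l)) as [->|Hm]; [lia|].
    assert (p m <> l) by (intro K; apply Hm, p_inj; congruence). lia.
  - destruct (lt_eq_lt_dec m (cnt l)) as [[h|h]|h]; [apply IH in h as h'; lia|subst; lia|].
    apply p_incr in h. lia.
Qed.

Definition next (l : nat) : (nat -> bool) -> nat -> bool := top_edge (cnt l).
Definition walk (l k : nat) (x : nat -> bool) : nat -> bool := Nat.iter k (next l) x.
Definition sink (l : nat) (x : nat -> bool) : Prop := forall m, m < cnt l -> ~ dom m x.

Lemma walk_S l k x : walk l (S k) x = walk l k (next l x).
Proof. apply Nat.iter_succ_r. Qed.

Lemma walk_add l j k x : walk l (k + j) x = walk l k (walk l j x).
Proof. apply Nat.iter_add. Qed.

Lemma walk_fix l k x : next l x = x -> walk l k x = x.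
Proof. intro H. induction k as [|k IH]; auto. rewrite walk_S, H; auto. Qed.

Lemma sink_next l x : sink l x -> next l x = x.
Proof.
  intro H. unfold next. destruct (top_edge_cases (cnt l) x) as [[E _]|(M & HM & Hx & _)]; auto.
  destruct (H M HM Hx).
Qed.

Lemma sink_agree l x y : agree l x y -> sink l x -> sink l y.
Proof.
  intros H Hx m Hm Hy. apply (Hx m Hm). apply dom_agree with (2 := Hy).
  apply cnt_spec in Hm. apply (agree_le _ l); auto.
Qed.

(** A move turns coordinate [p M] from false to true and keeps the earlier ones, so [num l] strictly
    increases. Being bounded by [2 ^ l], it forces walks to become stationary. *)
Lemma next_cases l x : sink l x \/
  exists M, p M < l /\ dom M x /\ next l x = f M x /\ num l x < num l (next l x) /\
    forall m, p m < l -> dom m x -> m <= M.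
Proof.
  unfold next. destruct (top_edge_cases (cnt l) x) as [[_ H]|(M & HM & Hx & E & H)]; [now left|right].
  exists M. assert (p M < l) by now apply cnt_spec. repeat split; auto.
  - rewrite E. apply num_lt with (p M); auto using dom_bit. apply agree_sym, f_agree.
  - intros m Hm. apply H. now apply cnt_spec.
Qed.

Lemma walk_num l k x : walk l k x = x \/ num l x < num l (walk l k x).
Proof.
  revert x; induction k as [|k IH]; intro x; auto. rewrite walk_S.
  destruct (next_cases l x) as [H|(M & _ & _ & _ & H & _)].
  - rewrite (sink_next l x H). apply IH.
  - right. destruct (IH (next l x)) as [->|]; lia.
Qed.

Lemma walk_stable l k x : 2 ^ l <= k -> walk l k x = walk l (2 ^ l) x.
Proof.
  assert (H : forall n, sink l (walk l n x) \/ n <= num l (walk l n x)).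
  { induction n as [|n IH]; [right; lia|]. change (walk l (S n) x) with (next l (walk l n x)).
    destruct IH as [IH|IH]; [left; now rewrite sink_next|].
    destruct (next_cases l (walk l n x)) as [K|(M & _ & _ & _ & K & _)]; [left; now rewrite sink_next|].
    right; lia. }
  intro Hk. replace k with ((k - 2 ^ l) + 2 ^ l) by lia. rewrite walk_add. apply walk_fix.
  apply sink_next. destruct (H (2 ^ l)) as [K|K]; auto.
  pose proof (num_bound l (walk l (2 ^ l) x)). lia.
Qed.

(* By absorption, the out-neighbours of [x] all lie on the walk started at [x]. *)
Lemma walk_reaches l m x : p m < l -> dom m x -> exists j, walk l (S j) x = f m x /\
  forall k, k <= j -> dom m (walk l k x) /\ f m (walk l k x) = f m x.
Proof.
  intros Hm.
  assert (H : forall b x, 2 ^ l - num l x <= b -> dom m x -> exists j, walk l (S j) x = f m x /\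
    forall k, k <= j -> dom m (walk l k x) /\ f m (walk l k x) = f m x).
  { clear x. induction b as [|b IH]; intros x Hb Hx.
    - pose proof (num_bound l x). lia.
    - destruct (next_cases l x) as [H|(M & HM & HMx & E & Hn & Hmax)].
      { destruct (H m); auto. now apply cnt_spec. }
      destruct (Nat.eq_dec m M) as [->|HmM].
      + exists 0. split; [exact E|]. intros k Hk. replace k with 0 by lia. auto.
      + assert (m < M) by (specialize (Hmax m Hm Hx); lia).
        destruct (IH (next l x)) as (j & Hj & Hjk).
        * pose proof (num_bound l (next l x)). lia.
        * rewrite E. now apply dom_f.
        * exists (S j). rewrite walk_S, Hj, E, f_absorb by auto. split; auto.
          intros [|k] Hk; [auto|]. rewrite walk_S. destruct (Hjk k) as [H1 H2]; [lia|].
          split; auto. rewrite H2, E. now apply f_absorb. }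
  intro Hx. exact (H _ x (Nat.le_refl _) Hx).
Qed.

(** The indices active at level [l] have positions below [p m], hence are smaller than [m], so [f m]
    is absorbed by whichever map [next l] applies. At a sink [next l] is the identity and absorbs
    nothing. *)
Lemma next_f l m x : l <= p m -> ~ sink l x -> next l (f m x) = next l x.
Proof.
  intros Hm Hs.
  assert (K : forall n, n <= cnt l -> (forall i, i < n -> ~ dom i x) \/ top_edge n (f m x) = top_edge n x).
  { induction n as [|n IH]; intros Hn; [left; lia|].
    assert (Hnm : n < m).
    { destruct (le_lt_dec m n) as [h|h]; auto. assert (m < cnt l) as K by lia.
      apply cnt_spec in K. lia. }
    pose proof (dom_f n m x Hnm) as Hd. cbn.
    destruct (excluded_middle_informative (dom n x)) as [Hx|Hx],
      (excluded_middle_informative (dom n (f m x))) as [Hy|Hy]; try tauto.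
    - right. now apply f_absorb.
    - destruct IH as [IH|IH]; [lia| |auto]. left. intros i Hi.
      destruct (Nat.eq_dec i n) as [->|]; auto. apply IH; lia. }
  destruct (K (cnt l)) as [H|H]; auto. contradiction.
Qed.

Lemma walk_f l m k x : l <= p m -> ~ sink l x -> walk l (S k) (f m x) = walk l (S k) x.
Proof. intros Hm Hs. rewrite !walk_S. now rewrite next_f. Qed.

Lemma sink_f l m x : l <= p m -> sink l x -> sink l (f m x).
Proof.
  intros Hm. apply sink_agree. apply agree_sym. apply (agree_le _ (p m)); auto using f_agree.
Qed.

(* Level [l] has one bit for each pair of a prefix of length [l] and a tuple of bits of the
   preceding levels: a point whose walk meets that pair records there its coordinate [l].
   The pairs are ordered so that a walk only moves up, hence a vertex is split before those it
   leads to. *)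
Fixpoint start (l : nat) : nat := match l with 0 => 0 | S l => start l + 2 ^ (l + start l) end.

Fixpoint lbit (l : nat) (x : nat -> bool) (j : nat) : bool := match l with
  | 0 => false
  | S l => if j <? start l then lbit l x j else
      decide (exists k, num l (walk l k x) * 2 ^ start l + num (start l) (lbit l (walk l k x))
                        = j - start l /\ walk l k x l = true) end.

(** The rank, within level [l], of the bit attached to the prefix and the earlier bits of [x]. *)
Definition key l x := num l x * 2 ^ start l + num (start l) (lbit l x).
Definition eqv l x y := agree (start l) (lbit l x) (lbit l y).
Definition nbit l x c := decide (exists k, key l (walk l k x) = c /\ walk l k x l = true).

Lemma lbit_old l x j : j < start l -> lbit (S l) x j = lbit l x j.
Proof. intro H. cbn [lbit]. apply Nat.ltb_lt in H. now rewrite H. Qed.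

Lemma lbit_new l x c : lbit (S l) x (start l + c) = nbit l x c.
Proof.
  cbn [lbit]. destruct (Nat.ltb_spec (start l + c) (start l)); [lia|].
  replace (start l + c - start l) with c by lia. reflexivity.
Qed.

Lemma key_bound l x : key l x < 2 ^ (l + start l).
Proof.
  unfold key. rewrite Nat.pow_add_r. pose proof (num_bound l x).
  pose proof (num_bound (start l) (lbit l x)).
  assert (S (num l x) * 2 ^ start l <= 2 ^ l * 2 ^ start l) by (apply Nat.mul_le_mono_r; lia). lia.
Qed.

Lemma key_lt l x y : num l x < num l y -> key l x < key l y.
Proof.
  unfold key. intro H. pose proof (num_bound (start l) (lbit l x)).
  assert (S (num l x) * 2 ^ start l <= num l y * 2 ^ start l) by (apply Nat.mul_le_mono_r; lia). lia.
Qed.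

Lemma key_eq l x y : key l x = key l y <-> agree l x y /\ eqv l x y.
Proof.
  split.
  - intro H. assert (E : num l x = num l y).
    { destruct (lt_eq_lt_dec (num l x) (num l y)) as [[h|h]|h]; auto; apply (key_lt l) in h; lia. }
    split; [now apply num_agree|]. apply num_agree. unfold key in H. rewrite E in H. lia.
  - intros [H1 H2]. apply num_agree in H1, H2. unfold key. now rewrite H1, H2.
Qed.

Lemma key_walk l k x : walk l k x = x \/ key l x < key l (walk l k x).
Proof. destruct (walk_num l k x) as [H|H]; [auto|right; now apply key_lt]. Qed.

(** Every actual move increases the key, so a walk passes at most one point with a given key, and
    the bit at that key records an unambiguous coordinate. *)
Lemma key_walk_inj l j k x : key l (walk l j x) = key l (walk l k x) -> walk l j x = walk l k x.
Proof.
  assert (H : forall j k, j <= k -> key l (walk l j x) = key l (walk l k x) -> walk l j x = walk l k x).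
  { clear j k; intros j k Hjk E. replace k with ((k - j) + j) in * by lia. rewrite walk_add in *.
    destruct (key_walk l (k - j) (walk l j x)) as [K|K]; [congruence|lia]. }
  intro E. destruct (le_lt_dec j k); [auto|symmetry; apply H; auto; lia].
Qed.

Lemma nbit_value l k x : nbit l x (key l (walk l k x)) = walk l k x l.
Proof.
  unfold nbit. destruct (walk l k x l) eqn:E.
  - apply decide_true. eauto.
  - destruct (decide _) eqn:K; auto. apply decide_true in K as (j & Hj & Hjl).
    apply key_walk_inj in Hj. congruence.
Qed.

Lemma nbit_value0 l x : nbit l x (key l x) = x l.
Proof. exact (nbit_value l 0 x). Qed.

Definition coherent l : Prop := forall x y, eqv l x y -> agree l x y /\ eqv l (next l x) (next l y).

Lemma eqv_walk l k x y : coherent l -> eqv l x y -> eqv l (walk l k x) (walk l k y).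
Proof.
  intros H. revert x y; induction k as [|k IH]; intros x y E; auto.
  rewrite !walk_S. apply IH. now apply H.
Qed.

Lemma eqv_key l k x y : coherent l -> eqv l x y -> key l (walk l k x) = key l (walk l k y).
Proof. intros H E. apply key_eq. pose proof (eqv_walk l k x y H E). split; auto. now apply H. Qed.

(** By coherence, the keys met by the walk from [x] depend only on the class of [x], and the bit at
    each of them is coordinate [l] of the point met there. *)
Lemma eqv_S l x y : coherent l ->
  (eqv (S l) x y <-> eqv l x y /\ forall k, walk l k x l = walk l k y l).
Proof.
  intro H. split.
  - intros E. assert (E' : eqv l x y).
    { intros j Hj. rewrite <- (lbit_old l x j), <- (lbit_old l y j) by auto. apply E. cbn [start]. lia. }
    split; auto. intro k. pose proof (eqv_key l k x y H E') as Hk.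
    rewrite <- !nbit_value, <- Hk, <- !lbit_new. apply E. cbn [start].
    pose proof (key_bound l (walk l k x)). lia.
  - intros [E K] j Hj. destruct (le_lt_dec (start l) j) as [h|h].
    + replace j with (start l + (j - start l)) by lia. rewrite !lbit_new. apply decide_iff.
      split; intros (k & Hk & Hl); exists k.
      * rewrite <- (eqv_key l k x y H E), <- K. auto.
      * rewrite (eqv_key l k x y H E), K. auto.
    + rewrite !lbit_old by auto. now apply E.
Qed.

Lemma eqv_trans l x y z : eqv l x y -> eqv l y z -> eqv l x z.
Proof. apply agree_trans. Qed.

Lemma eqv_sym l x y : eqv l x y -> eqv l y x.
Proof. apply agree_sym. Qed.

(** The two claims need each other. Passing to level [l + 1] may activate an index [n] with
    [p n = l], and then the successor of [x] can become [f n x]; its class is controlled by the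
    second claim, that maps of position at least [l] are invisible at level [l]. *)
Lemma coherence l : coherent l /\ forall m x, l <= p m -> eqv l x (f m x).
Proof.
  induction l as [|l [Hc Hf]].
  { split; [|intros m x _ j Hj; cbn in Hj; lia].
    intros x y _; split; intros j Hj; cbn in Hj; lia. }
  split.
  - intros x y E. apply (eqv_S l x y Hc) in E as [E K].
    assert (HA : agree (S l) x y).
    { intros k Hk. destruct (Nat.eq_dec k l) as [->|]; [apply (K 0)|]. apply (Hc x y E). lia. }
    split; auto.
    assert (Hnext : eqv (S l) (next l x) (next l y)).
    { apply (eqv_S l _ _ Hc). split; [now apply Hc|]. intro k. rewrite <- !walk_S. apply K. }
    unfold next in *. cbn [cnt]. destruct (Nat.eqb_spec (p (cnt l)) l) as [Ep|Ep]; auto.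
    set (n := cnt l) in *. cbn [top_edge].
    assert (Hd : dom n x <-> dom n y).
    { split; apply dom_agree; rewrite Ep; auto. now apply agree_sym. }
    destruct (excluded_middle_informative (dom n x)) as [Hx|Hx],
      (excluded_middle_informative (dom n y)) as [Hy|Hy]; try tauto.
    apply (eqv_S l _ _ Hc). assert (Hl : l <= p n) by lia. split.
    { apply eqv_trans with x; [now apply eqv_sym, Hf|]. apply eqv_trans with y; auto. }
    assert (Hfl : forall z, f n z l = true) by (intro z; rewrite <- Ep; apply f_flip).
    assert (HAl : agree l x y) by (apply (agree_le l (S l)); auto).
    intros [|k]; [cbn; now rewrite !Hfl|].
    destruct (classic (sink l x)) as [Hs|Hs].
    + rewrite !walk_fix; [now rewrite !Hfl| |]; apply sink_next, sink_f; auto.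
      apply (sink_agree l x); auto.
    + rewrite !walk_f; auto. intro Hs'; apply Hs, (sink_agree l y); auto. now apply agree_sym.
  - intros m x Hm. apply (eqv_S l _ _ Hc). split; [apply Hf; lia|].
    assert (E : f m x l = x l) by (apply f_below; lia).
    intros [|k]; [now symmetry|].
    destruct (classic (sink l x)) as [Hs|Hs].
    + rewrite !walk_fix; auto; apply sink_next; auto. apply sink_f; auto; lia.
    + now rewrite walk_f by (auto; lia).
Qed.

Lemma lbit_stable l l' x j : l <= l' -> j < start l -> lbit l' x j = lbit l x j.
Proof.
  intros H Hj. induction H as [|l' H IH]; auto. rewrite lbit_old; auto.
  clear IH. induction H as [|l' H IH]; auto. cbn [start]. lia.
Qed.

Lemma start_ge l : l <= start l.
Proof.
  induction l as [|l IH]; cbn [start]; [lia|].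
  pose proof (Nat.pow_nonzero 2 (l + start l)). lia.
Qed.

Definition level_bit j x := lbit (S j) x j.

Lemma bit_lbit l x j : j < start l -> lbit l x j = level_bit j x.
Proof.
  intro H. unfold level_bit. assert (H' : j < start (S j)) by (pose proof (start_ge (S j)); lia).
  rewrite <- (lbit_stable l (max l (S j))), <- (lbit_stable (S j) (max l (S j))); auto; lia.
Qed.

Lemma bit_nbit l x c : c < 2 ^ (l + start l) -> level_bit (start l + c) x = nbit l x c.
Proof. intro H. rewrite <- lbit_new. symmetry. apply bit_lbit. cbn [start]. lia. Qed.

Lemma next_continuous l x k : exists N, forall y, agree N y x -> next l y k = next l x k.
Proof.
  unfold next. generalize (cnt l) as n. induction n as [|n [N HN]]; cbn.
  - exists (S k). intros y Hy. apply Hy; lia.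
  - destruct (f_continuous n x k) as [M HM]. exists (max (S (p n)) (max N M)). intros y Hy.
    assert (Hd : agree (S (p n)) y x) by (apply (agree_le _ (max (S (p n)) (max N M))); auto; lia).
    assert (dom n x <-> dom n y) by (split; apply dom_agree; auto using agree_sym).
    destruct (excluded_middle_informative (dom n x)), (excluded_middle_informative (dom n y)); try tauto.
    + apply HM. apply (agree_le _ (max (S (p n)) (max N M))); auto; lia.
    + apply HN. apply (agree_le _ (max (S (p n)) (max N M))); auto; lia.
Qed.

Lemma walk_continuous l n x k : exists N, forall y, agree N y x -> walk l n y k = walk l n x k.
Proof.
  revert x k; induction n as [|n IH]; intros x k.
  - exists (S k). intros y Hy. apply Hy; lia.
  - destruct (next_continuous l (walk l n x) k) as [M HM].
    destruct (finite_bound (fun k N => forall y, agree N y x -> walk l n y k = walk l n x k) M) as [N HN].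
    + intros j N N' Hle H y Hy. apply H. eapply agree_le; eauto.
    + intros j _. apply IH.
    + exists N. intros y Hy. apply HM. intros j Hj. now apply HN.
Qed.

(** A class is determined by single coordinates along walks that are stationary after [2 ^ l] steps,
    hence by finitely many continuous conditions. *)
Lemma eqv_open l x : exists N, forall y, agree N y x -> eqv l y x.
Proof.
  induction l as [|l [N HN]]; [exists 0; intros y _ j Hj; cbn in Hj; lia|].
  destruct (finite_bound (fun k M => forall y, agree M y x -> walk l k y l = walk l k x l)
    (S (2 ^ l))) as [M HM].
  - intros j M M' Hle H y Hy. apply H. eapply agree_le; eauto.
  - intros j _. apply walk_continuous.
  - exists (max N M). intros y Hy. apply eqv_S; [apply coherence|].
    split; [apply HN; apply (agree_le _ (max N M)); auto; lia|].
    assert (HyM : agree M y x) by (apply (agree_le _ (max N M)); auto; lia).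
    intro k. destruct (le_lt_dec (2 ^ l) k) as [h|h].
    + rewrite !(walk_stable l k) by auto. apply HM; auto.
    + apply HM; auto.
Qed.

Lemma level_bit_continuous j x : exists n, forall y, agree n y x -> level_bit j y = level_bit j x.
Proof.
  destruct (eqv_open (S j) x) as [N HN]. exists N. intros y Hy. apply (HN y Hy).
  pose proof (start_ge (S j)). lia.
Qed.

Lemma level_bit_injective x y : (forall j, level_bit j x = level_bit j y) -> x = y.
Proof.
  intro H. extensionality k. apply (proj1 (coherence (S k)) x y); [|lia].
  intros j Hj. rewrite !bit_lbit by auto. apply H.
Qed.

Lemma level_decomposition i : exists l c, i = start l + c /\ c < 2 ^ (l + start l).
Proof.
  induction i as [|i (l & c & -> & Hc)]; [exists 0, 0; cbn; lia|].
  destruct (le_lt_dec (2 ^ (l + start l)) (S c)) as [h|h].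
  - exists (S l), 0. cbn [start]. split; [lia|].
    pose proof (Nat.pow_nonzero 2 (S l + (start l + 2 ^ (l + start l)))). lia.
  - exists l, (S c). lia.
Qed.

Lemma code_level l c x y : c <= 2 ^ (l + start l) ->
  (code level_bit (start l + c) x = code level_bit (start l + c) y <->
   eqv l x y /\ forall c', c' < c -> nbit l x c' = nbit l y c').
Proof.
  intro Hc. rewrite code_eq. split.
  - intro H; split.
    + intros j Hj. rewrite !bit_lbit by auto. apply H; lia.
    + intros c' Hc'. rewrite <- !bit_nbit by lia. apply H; lia.
  - intros [H1 H2] j Hj. destruct (le_lt_dec (start l) j) as [h|h].
    + replace j with (start l + (j - start l)) by lia. rewrite !bit_nbit by lia. apply H2; lia.
    + rewrite <- !(bit_lbit l) by auto. now apply H1.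
Qed.

(** Ends of the same class at level [l] force [l <= p n], so [f n] is absorbed after one step of the
    walk, unless [x] is a sink and no step moves. Either way only the starting point can contribute
    a different bit. *)
Lemma new_edge l n x c : dom n x -> eqv l x (f n x) -> nbit l x c <> nbit l (f n x) c ->
  key l x = c /\ nbit l x c = false.
Proof.
  intros Hx E Hb. destruct (proj1 (coherence l) x (f n x) E) as [HA _].
  assert (Hn : l <= p n).
  { destruct (le_lt_dec l (p n)) as [h|h]; auto. specialize (HA _ h).
    rewrite f_flip, (dom_bit n x Hx) in HA. discriminate. }
  assert (Hk : key l x = key l (f n x)) by now apply key_eq.
  destruct (Nat.eq_dec (key l x) c) as [<-|Hc].
  - split; auto. rewrite nbit_value0. rewrite nbit_value0, Hk, nbit_value0 in Hb.
    destruct (Nat.eq_dec l (p n)) as [->|]; [now apply dom_bit|].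
    destruct Hb. symmetry. apply f_below. lia.
  - destruct Hb. apply decide_iff. destruct (classic (sink l x)) as [Hs|Hs].
    + pose proof (sink_f l n x Hn Hs) as Hs'. apply sink_next in Hs, Hs'.
      split; intros (k & K & _); rewrite walk_fix in K by auto; lia.
    + split; intros ([|k] & K & K'); try (cbn in K; lia); exists (S k).
      * now rewrite walk_f.
      * now rewrite walk_f in K, K'.
Qed.

Section Splits.
Variables (Y : Polish) (Bm : nat -> Y -> Y -> Prop).
Hypothesis Bm_irrefl : forall m a, ~ Bm m a a.
Hypothesis Bm_functional : forall m a b b', Bm m a b -> Bm m a b' -> b = b'.
Hypothesis Bm_absorb : forall m M a a' b b', m < M -> Bm M a a' -> Bm m a b -> Bm m a' b' -> b = b'.

(** Bit [i] is number [c] of level [l], and the gluing vertex is the common code of all points with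
    key [c]. *)
Lemma absorbing_splits i : exists v, splits Y Bm (graph_of t f) level_bit i v.
Proof.
  assert (HG : forall x y, graph_of t f x y <-> exists n, dom n x /\ y = f n x).
  { intros x y; split; intros (n & Hn & E); exists n; split; auto; [now extensionality k|congruence]. }
  destruct (level_decomposition i) as (l & c & -> & Hc).
  destruct (classic (exists x, key l x = c)) as [[x0 Hx0]|Hno].
  (* No point has this key, so the bit is constantly false and any word of the right length
     serves. *)
  2:{ exists (code level_bit (start l + c) (fun _ => false)).
    assert (Hb : forall x, level_bit (start l + c) x = false).
    { intro x. rewrite bit_nbit by auto. destruct (nbit l x c) eqn:E; auto.
      apply decide_true in E as (k & Hk & _). destruct Hno; eauto. }
    split; [apply code_length|split].
    - intros x y _ _ H. now rewrite !Hb in H.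
    - intros; split; intros x y; rewrite !Hb; congruence. }
  exists (code level_bit (start l + c) x0).
  assert (Hv : forall x, key l x = c -> code level_bit (start l + c) x = code level_bit (start l + c) x0).
  { intros x Hx. apply code_level; [lia|]. split.
    - apply (key_eq l x x0). congruence.
    (* Walks only move up: from a point of key [c] they meet no smaller key, so the preceding bits
       of the level are all false there. *)
    - assert (Hz : forall z c', key l z = c -> c' < c -> nbit l z c' = false).
      { intros z c' Hz Hc'. destruct (nbit l z c') eqn:E; auto.
        apply decide_true in E as (k & Hk & _). destruct (key_walk l k z) as [K|K]; [|lia].
        rewrite K in Hk; lia. }
      intros c' Hc'. now rewrite !Hz. }
  assert (Hedge : forall n x, dom n x -> p n < l -> exists j,
    edge (graph_of t f) level_bit (start l + c) j (code level_bit (start l + c) x) (code level_bit (start l + c) (f n x))).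
  { intros n x Hx Hn. destruct (code_difference level_bit (start l + c) x (f n x)) as (j & Hj & E & Eb).
    - intro E. apply code_level in E as [E _]; [|lia].
      apply (proj1 (coherence l)) in E as [E _]. specialize (E _ Hn).
      rewrite f_flip, (dom_bit n x Hx) in E. discriminate.
    - exists j, x, (f n x). repeat split; auto. apply HG; eauto. }
  split; [apply code_length|split].
  - intros x y Hxy E Hb. apply HG in Hxy as (n & Hx & ->). rewrite !bit_nbit in * by auto.
    apply code_level in E as [E _]; [|lia]. destruct (new_edge l n x c Hx E Hb); auto.
  - intros lab g g' Hlab Hg Hg' Hvv. split.
    + intros x y Hxy E Hb. apply HG in Hxy as (n & Hx & ->). rewrite !bit_nbit in Hb by auto.
      destruct (le_lt_dec l (p n)) as [h|h].
      * exfalso. apply E. apply code_level; [lia|]. pose proof (proj2 (coherence l) n x h) as K.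
        split; auto. intros c' Hc'.
        destruct (Bool.bool_dec (nbit l x c') (nbit l (f n x) c')) as [|Hb']; auto.
        pose proof (new_edge l n x c Hx K Hb). pose proof (new_edge l n x c' Hx K Hb'). lia.
      * destruct (walk_reaches l n x h Hx) as (j & Hj & Hjk).
        (* The bit differs at the two ends only if the walk passes a point of key [c] before
           reaching [f n x]. This point has the code of the gluing vertex and the same image under
           [f n], so [Bm_absorb], applied to the new edge, identifies the two copies of the
           image. *)
        assert (Hk : exists k, k <= j /\ key l (walk l k x) = c).
        { apply NNPP; intro Hnk. apply Hb. apply decide_iff. rewrite <- Hj.
          split; intros (k & Hk & Hkl).
          - destruct (le_lt_dec k j) as [hk|hk]; [destruct Hnk; eauto|].
            exists (k - S j). rewrite <- walk_add. replace (k - S j + S j) with k by lia. auto.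
          - rewrite <- walk_add in *. eauto. }
        destruct Hk as (k & Hkj & Hk). destruct (Hjk k Hkj) as [Hd Hf].
        destruct (Hedge n _ Hd h) as (i & Hi). rewrite Hf, (Hv _ Hk) in Hi.
        assert (i < start l + c) by (destruct Hi as (? & ? & _ & ? & _); auto).
        exact (Bm_absorb _ _ _ _ _ _ (Hlab i _ H (Nat.le_refl _)) Hvv (Hg _ _ _ Hi) (Hg' _ _ _ Hi)).
    + assert (Hk : forall k x, key l (walk l k x) = c ->
        g (code level_bit (start l + c) x) <> g' (code level_bit (start l + c) x)).
      (* Distinctness of the copies spreads backwards along the walk, since equal sources have equal
         successors by [Bm_functional]. *)
      { induction k as [|k IH]; intros x Hk.
        - rewrite (Hv x Hk). intro E. rewrite E in Hvv. exact (Bm_irrefl _ _ Hvv).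
        - rewrite walk_S in Hk. destruct (next_cases l x) as [Hs|(M & HM & Hx & E & _)].
          + rewrite sink_next in Hk by auto. auto.
          + intro Eg. apply (IH _ Hk). destruct (Hedge M x Hx HM) as (j & Hj). rewrite E.
            apply (Bm_functional (lab j) (g (code level_bit (start l + c) x))); [now apply Hg|].
            rewrite Eg. now apply Hg'. }
      intros x y E Hb. rewrite !bit_nbit in Hb by auto.
      destruct (nbit l x c) eqn:Ex; [apply decide_true in Ex as (k & K & _); eauto|].
      destruct (nbit l y c) eqn:Ey; [|congruence].
      apply decide_true in Ey as (k & K & _). rewrite E. eauto.
Qed.
End Splits.
End Absorbing.

(** * The digraphs [G0] and [G1] *)

Lemma psi_length n : length (psi n) = Nat.log2 (S n).
Proof. unfold psi. now rewrite length_map, length_seq. Qed.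

Lemma psi_length_le n : length (psi n) <= n.
Proof.
  rewrite psi_length. destruct n as [|n]; [auto|]. pose proof (Nat.log2_lt_lin (S (S n))). lia.
Qed.

Lemma s_seq_length n : length (s_seq n) = n.
Proof.
  unfold s_seq. rewrite length_app, repeat_length. pose proof (psi_length_le n). lia.
Qed.

Lemma q_incr m n : m < n -> q m < q n.
Proof.
  intro H. induction H as [|n H IH]; cbn [q]; [pose proof (Nat.pow_gt_lin_r 2 (q m))|
    pose proof (Nat.pow_gt_lin_r 2 (q n))]; lia.
Qed.

Lemma q_ge n : n <= q n.
Proof. induction n as [|n IH]; [auto|]. pose proof (q_incr n (S n)). lia. Qed.

Lemma t_seq_length n : length (t_seq n) = 2 ^ q n.
Proof.
  unfold t_seq. rewrite length_app, repeat_length. pose proof (psi_length_le n).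
  pose proof (q_ge n). pose proof (Nat.pow_gt_lin_r 2 (q n)). lia.
Qed.

Definition flip (n : nat) (x : nat -> bool) : nat -> bool := fun k => if k =? n then true else x k.

Lemma extends_self_prepend s g : extends s (prepend s g).
Proof. intros k Hk. unfold prepend. apply Nat.ltb_lt in Hk. now rewrite Hk. Qed.

Lemma G0_graph x y : G0 x y <-> graph_of s_seq flip x y.
Proof.
  assert (E : forall n b g k, prepend (s_seq n ++ [b]) g k =
    if k <? n then nth k (s_seq n) false else if k =? n then b else g (k - S n)).
  { intros n b g k. unfold prepend. rewrite length_app, s_seq_length; cbn [length].
    destruct (Nat.ltb_spec k n), (Nat.ltb_spec k (n + 1)), (Nat.eqb_spec k n); try lia.
    - rewrite app_nth1; auto. now rewrite s_seq_length.
    - subst. rewrite app_nth2; rewrite s_seq_length; [|lia]. now rewrite Nat.sub_diag.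
    - f_equal; lia. }
  split.
  - intros (n & g & Hx & Hy). exists n. split.
    + replace x with (prepend (s_seq n ++ [false]) g) by (extensionality k; auto).
      apply extends_self_prepend.
    + intro k. unfold flip. rewrite Hy, Hx, !E.
      destruct (Nat.ltb_spec k n), (Nat.eqb_spec k n); auto; lia.
  - intros (n & Hx & Hy). exists n, (fun k => x (S n + k)).
    apply extends_snoc in Hx as [Hs Hx]. unfold extends in Hs. rewrite s_seq_length in *.
    split; intro k; rewrite E; rewrite ?Hy; unfold flip;
      destruct (Nat.ltb_spec k n), (Nat.eqb_spec k n); subst; auto; try lia; f_equal; lia.
Qed.

Lemma flip_continuous n x k : exists N, forall y, agree N y x -> flip n y k = flip n x k.
Proof.
  exists (S k). intros y Hy. unfold flip. destruct (k =? n); auto.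
Qed.

Lemma flip_flip n x : flip n x (length (s_seq n)) = true.
Proof. unfold flip. now rewrite s_seq_length, Nat.eqb_refl. Qed.

Section CoordinateSplits.
Variables (Y : Polish) (Bm : nat -> Y -> Y -> Prop).
Hypothesis Bm_irrefl : forall m a, ~ Bm m a a.
Hypothesis Bm_functional : forall m a b b', Bm m a b -> Bm m a b' -> b = b'.
Hypothesis Bm_injective : forall m a a' b, Bm m a b -> Bm m a' b -> a = a'.
Let bit (j : nat) (x : nat -> bool) : bool := x j.

(** The finite approximations of [G0] are connected: to change coordinate [k], bring the coordinates
    below [k] to [s_seq k] by induction, cross the edge, and adjust them again. *)
Lemma G0_edge_invariant i (P : list bool -> Prop) :
  (forall j s t, edge (graph_of s_seq flip) bit i j s t -> (P s <-> P t)) ->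
  forall k x y, k <= i -> (forall m, k <= m -> m < i -> x m = y m) ->
  (P (code bit i x) <-> P (code bit i y)).
Proof.
  intros HP. induction k as [|k IH]; intros x y Hk Hxy.
  - replace (code bit i y) with (code bit i x); [tauto|]. apply code_eq. intros j Hj. apply Hxy; lia.
  - assert (Hsym : forall x y, (forall m, S k <= m -> m < i -> x m = y m) ->
      x k = false -> y k = true -> (P (code bit i x) <-> P (code bit i y))).
    { clear x y Hxy. intros x y Hxy Hx Hy.
      set (a := fun m => if m <? k then nth m (s_seq k) false else x m).
      assert (Ha : a k = false) by (unfold a; now rewrite Nat.ltb_irrefl).
      rewrite (IH x a), <- (IH (flip k a) y).
      - apply (HP k). exists a, (flip k a). split; [|split; [|split; [|split]]]; auto.
        + exists k; split; auto. apply extends_snoc. rewrite s_seq_length. split; auto.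
          intros m Hm. rewrite s_seq_length in Hm. unfold a. apply Nat.ltb_lt in Hm. now rewrite Hm.
        + apply code_eq. intros m Hm. unfold bit, flip. destruct (Nat.eqb_spec m k); [lia|auto].
        + unfold bit, flip. rewrite Ha, Nat.eqb_refl. discriminate.
      - lia.
      - intros m Hm Hmi. unfold flip. destruct (Nat.eqb_spec m k) as [->|]; auto.
        unfold a. destruct (Nat.ltb_spec m k); [lia|]. apply Hxy; lia.
      - lia.
      - intros m Hm Hmi. unfold a. destruct (Nat.ltb_spec m k); [lia|auto]. }
    destruct (x k) eqn:Ex, (y k) eqn:Ey; try (apply Hsym; auto; fail).
    + apply IH; [lia|]. intros m Hm Hmi. destruct (Nat.eq_dec m k) as [->|]; [congruence|apply Hxy; lia].
    + symmetry. apply Hsym; auto. intros m Hm Hmi. symmetry; apply Hxy; lia.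
    + apply IH; [lia|]. intros m Hm Hmi. destruct (Nat.eq_dec m k) as [->|]; [congruence|apply Hxy; lia].
Qed.

(** With its label, an edge determines each end from the other, so equality of the two copies at one
    word spreads to all words by connectedness, contradicting the new edge at [s_seq i]. An edge
    changes a single coordinate, which makes the identification clause vacuous. *)
Lemma coordinate_splits i : exists v, splits Y Bm (graph_of s_seq flip) bit i v.
Proof.
  exists (s_seq i). split; [apply s_seq_length|split].
  - intros x y (n & Hx & Hy) E Hb. unfold bit in Hb. rewrite Hy in Hb. unfold flip in Hb.
    destruct (Nat.eqb_spec i n) as [<-|]; [|congruence].
    apply extends_snoc in Hx as [Hs Hx]. rewrite s_seq_length in Hx. split; auto.
    apply nth_ext with false false; rewrite code_length; [now rewrite s_seq_length|].
    intros k Hk. rewrite <- (Hs k) by now rewrite s_seq_length.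
    now rewrite code_nth.
  - intros lab g g' _ Hg Hg' Hv. split.
    + intros x y (n & Hx & Hy) E Hb. destruct E. apply code_eq. intros j Hj.
      unfold bit in *. rewrite Hy in *. unfold flip in *.
      destruct (Nat.eqb_spec i n) as [->|]; [|congruence].
      destruct (Nat.eqb_spec j n); [lia|auto].
    + intros x _ _ _.
      assert (Hc : forall s t, length s = i -> length t = i -> (g s = g' s <-> g t = g' t)).
      { assert (Hl : forall s, length s = i -> s = code bit i (fun k => nth k s false)).
        { intros s Hs. apply nth_ext with false false; [now rewrite code_length|].
          intros k Hk. now rewrite code_nth by lia. }
        intros s t Hs Ht. rewrite (Hl s Hs), (Hl t Ht).
        apply (G0_edge_invariant i (fun s => g s = g' s)) with (k := i); [|lia|intros; lia].
        intros j a b Hab. pose proof (Hg _ _ _ Hab) as H1. pose proof (Hg' _ _ _ Hab) as H2.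
        split; intro E; rewrite E in H1; eauto. }
      rewrite (Hc _ (s_seq i)); [|apply code_length|apply s_seq_length].
      intro E. rewrite E in Hv. exact (Bm_irrefl _ _ Hv).
Qed.
End CoordinateSplits.

(** * Absorption for the maps defining [G1] *)

Lemma theta_fixed n k : ~ (k mod 2 ^ q n = 0 /\ 0 < k) -> theta n k = k.
Proof.
  intro H. unfold theta. destruct (Nat.eqb_spec (k mod 2 ^ q n) 0), (Nat.ltb_spec 0 k); cbn; auto.
  tauto.
Qed.

Lemma theta_multiple n k : k mod 2 ^ q n = 0 -> 0 < k ->
  theta n k = 2 ^ q n * (2 * (k / 2 ^ q n) + 1).
Proof.
  intros H Hk. unfold theta. destruct (Nat.eqb_spec (k mod 2 ^ q n) 0), (Nat.ltb_spec 0 k); cbn; auto; lia.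
Qed.

(* The values of [theta m] have 2-adic valuation at most [q m]. *)
Lemma theta_avoids m n k : m < n -> ~ (theta m k mod 2 ^ q n = 0 /\ 0 < theta m k).
Proof.
  intros Hmn [H H'].
  assert (E : 2 ^ q n = 2 ^ q m * (2 * 2 ^ (q n - q m - 1))).
  { apply q_incr in Hmn. rewrite <- Nat.pow_succ_r', <- Nat.pow_add_r. f_equal; lia. }
  assert (Hp : 2 ^ q m <> 0) by now apply Nat.pow_nonzero.
  apply Nat.Lcm0.mod_divide in H as [r Hr]. rewrite E in Hr.
  destruct (classic (k mod 2 ^ q m = 0 /\ 0 < k)) as [[H1 H2]|Hk].
  - rewrite theta_multiple in Hr by auto.
    rewrite (Nat.mul_comm r), <- !Nat.mul_assoc in Hr. apply Nat.mul_cancel_l in Hr; auto. lia.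
  - rewrite theta_fixed in * by auto. apply Hk. split; auto.
    apply Nat.Lcm0.mod_divide. exists (r * (2 * 2 ^ (q n - q m - 1))). lia.
Qed.

Lemma g_map_below n x k : k < length (t_seq n) -> g_map n x k = x k.
Proof.
  rewrite t_seq_length. intro H. unfold g_map. destruct (Nat.eqb_spec k (2 ^ q n)); [lia|].
  rewrite theta_fixed; auto. rewrite Nat.mod_small by auto. lia.
Qed.

Lemma g_map_flip n x : g_map n x (length (t_seq n)) = true.
Proof. unfold g_map. now rewrite t_seq_length, Nat.eqb_refl. Qed.

Lemma g_map_continuous n x k : exists N, forall y, agree N y x -> g_map n y k = g_map n x k.
Proof.
  exists (S (theta n k)). intros y Hy. unfold g_map. destruct (k =? _); auto.
Qed.

(** Away from [2 ^ q m], [g_map m] reads coordinates [theta m k]; these are fixed by [theta n] and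
    differ from [2 ^ q n], so [g_map n] leaves them unchanged. *)
Lemma g_map_absorb m n x : m < n -> g_map m (g_map n x) = g_map m x.
Proof.
  intro H. extensionality k. unfold g_map at 1 3. destruct (k =? 2 ^ q m); auto.
  pose proof (theta_avoids m n k H) as K. unfold g_map. rewrite (theta_fixed n (theta m k)) by auto.
  destruct (Nat.eqb_spec (theta m k) (2 ^ q n)) as [E|]; auto. destruct K.
  rewrite E. split; [apply Nat.Div0.mod_same|]. pose proof (Nat.pow_nonzero 2 (q n)). lia.
Qed.

Lemma t_seq_incr m n : m < n -> length (t_seq m) < length (t_seq n).
Proof.
  intro H. rewrite !t_seq_length. apply Nat.pow_lt_mono_r; [lia|]. now apply q_incr.
Qed.

Section Embeddings.
Variables (Y : Polish) (B : Y -> Y -> Prop) (h : Y -> nat -> bool).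
Hypothesis HB : analytic_rel Y B.
Hypothesis HBc : ~ countable_borel_chromatic Y B.
Hypothesis h_borel : borel_fun Y Cantor h.
Hypothesis h_inj : injective h.

Lemma part_functional t f m a b b' : part t f Y B h m a b -> part t f Y B h m a b' -> b = b'.
Proof.
  intros (_ & _ & E) (_ & _ & E'). apply h_inj. extensionality k. congruence.
Qed.

Lemma part_irrefl t f m a : (forall n x, f n x (length (t n)) = true) -> ~ part t f Y B h m a a.
Proof.
  intros Hf (_ & H & E). apply extends_snoc in H as [_ H]. rewrite E, Hf in H. discriminate.
Qed.

Theorem G0_embeds : (forall x y, B x y -> G0 (h x) (h y)) -> red_le RC Cantor G0 Y B.
Proof.
  intro Hhom.
  destruct (embeds_below s_seq flip flip_continuous (fun n x _ => flip_flip n x) (fun j x => x j))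
    with (Y := Y) (B := B) (h := h) as (k & H1 & H2 & H3); auto.
  - intros j x. exists (S j). intros y Hy. apply Hy; lia.
  - intros x y H. extensionality j. auto.
  - intros x y Hxy. now apply G0_graph, Hhom.
  - apply coordinate_splits.
    + intros m a. apply part_irrefl, flip_flip.
    + apply part_functional.
    + intros m a a' b (_ & Ha & E) (_ & Ha' & E'). apply h_inj. extensionality j.
      apply extends_snoc in Ha as [_ Ha], Ha' as [_ Ha'].
      rewrite s_seq_length in *.
      specialize (E j). specialize (E' j). unfold flip in E, E'.
      destruct (Nat.eqb_spec j m); congruence.
  - exists k; split; [|split]; auto. intros x y Hxy. apply H3. now apply G0_graph.
Qed.

Theorem G1_embeds : (forall x y, B x y -> G1 (h x) (h y)) -> red_le RC Cantor G1 Y B.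
Proof.
  intro Hhom.
  destruct (embeds_below t_seq g_map g_map_continuous (fun n x _ => g_map_flip n x)
    (level_bit t_seq g_map))
    with (Y := Y) (B := B) (h := h) as (k & H1 & H2 & H3); auto.
  - apply level_bit_continuous; auto using t_seq_incr, g_map_below, g_map_flip, g_map_continuous, g_map_absorb.
  - apply level_bit_injective; auto using t_seq_incr, g_map_below, g_map_flip, g_map_continuous, g_map_absorb.
  - apply absorbing_splits; auto using t_seq_incr, g_map_below, g_map_flip, g_map_continuous, g_map_absorb.
    + intros m a. apply part_irrefl, g_map_flip.
    + apply part_functional.
    (* Injectivity of [h] turns absorption for the maps into absorption for the labelled edges of
       [B]. *)
    + intros m M a a' b b' HmM (_ & _ & E) (_ & _ & E1) (_ & _ & E2).
      apply h_inj. extensionality j. rewrite E1, E2.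
      replace (h a') with (g_map M (h a)) by (extensionality i; auto).
      now rewrite g_map_absorb.
  - exists k; auto.
Qed.
End Embeddings.

(** * Baire category and chromatic numbers *)

Lemma extends_prefix n (x y : nat -> bool) : extends (prefix n x) y <-> agree n y x.
Proof.
  unfold extends, prefix, agree. rewrite length_map, length_seq.
  split; intros H k Hk; rewrite (H k Hk); rewrite nth_indep with (d' := x 0)
    by (now rewrite length_map, length_seq); now rewrite map_nth, seq_nth.
Qed.

Lemma prefix_length {T} n (x : nat -> T) : length (prefix n x) = n.
Proof. unfold prefix. now rewrite length_map, length_seq. Qed.

Lemma extends_app s l x : extends (s ++ l) x -> extends s x.
Proof. intros H k Hk. rewrite H by (rewrite length_app; lia). now rewrite app_nth1. Qed.

Lemma extends_point s : exists x, extends s x.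
Proof. exists (fun k => nth k s false). intros k Hk; auto. Qed.

Lemma prefix_extends s n x : extends s x -> length s <= n -> exists l, prefix n x = s ++ l.
Proof.
  intros Hs Hn. exists (map x (seq (length s) (n - length s))). unfold prefix.
  replace n with (length s + (n - length s)) at 1 by lia. rewrite seq_app, map_app. f_equal.
  apply nth_ext with false false; rewrite length_map, length_seq; auto.
  intros k Hk. rewrite nth_indep with (d' := x 0) by now rewrite length_map, length_seq.
  rewrite map_nth, seq_nth by auto. now apply Hs.
Qed.

Lemma cantor_open_basic U s x : cantor_open U -> extends s x -> U x ->
  exists l, l <> [] /\ forall y, extends (s ++ l) y -> U y.
Proof.
  intros HU Hs Ux. destruct (HU x Ux) as [n Hn].
  destruct (prefix_extends s (n + length s + 1) x Hs) as [l Hl]; [lia|].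
  exists l. split.
  - intros ->. apply (f_equal (@length bool)) in Hl. rewrite prefix_length, app_nil_r in Hl. lia.
  - intros y Hy. rewrite <- Hl, extends_prefix in Hy. apply Hn. intros k Hk. apply Hy; lia.
Qed.

(** Comeagerness in the basic clopen set of [s], on which alone the open sets have to be dense. *)
Definition comeager (s : list bool) (A : (nat -> bool) -> Prop) : Prop :=
  exists O : nat -> (nat -> bool) -> Prop, (forall k, cantor_open (O k)) /\
    (forall k l, exists x, extends (s ++ l) x /\ O k x) /\
    forall x, extends s x -> (forall k, O k x) -> A x.

Lemma baire_category s A : comeager s A -> exists x, extends s x /\ A x.
Proof.
  intros (O & Ho & Hd & HS).
  assert (K : forall k l, exists l', l' <> [] /\ forall y, extends (s ++ l ++ l') y -> O k y).
  { intros k l. destruct (Hd k l) as (x & Hx & Ox).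
    destruct (cantor_open_basic _ _ _ (Ho k) Hx Ox) as (l' & Hl & H).
    exists l'. rewrite app_assoc. auto. }
  assert (K' : forall p : nat * list bool, exists l', l' <> [] /\
    forall y, extends (s ++ snd p ++ l') y -> O (fst p) y) by (intros [k l]; apply K).
  apply choice in K' as [ext Hext].
  pose (L := fix L k := match k with 0 => [] | S k => L k ++ ext (k, L k) end).
  assert (Hlen : forall k, k <= length (L k)).
  { induction k as [|k IH]; cbn [L]; [lia|]. rewrite length_app.
    destruct (Hext (k, L k)) as [H _]. destruct (ext (k, L k)); [congruence|cbn; lia]. }
  assert (Hnest : forall j k, j <= k -> exists l, L k = L j ++ l).
  { intros j k Hjk. induction Hjk as [|k Hjk [l IH]]; [exists []; now rewrite app_nil_r|].
    exists (l ++ ext (k, L k)). cbn [L]. now rewrite IH at 1; rewrite app_assoc. }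
  pose (x := fun j => nth j (s ++ L (S j)) false).
  assert (Hx : forall k, extends (s ++ L k) x).
  { intros k j Hj. unfold x. destruct (le_lt_dec k (S j)) as [h|h].
    - destruct (Hnest k (S j) h) as [l ->]. rewrite app_assoc. now rewrite (app_nth1 (s ++ L k)).
    - destruct (Hnest (S j) k) as [l ->]; [lia|]. rewrite app_assoc, (app_nth1 (s ++ L (S j))); auto.
      rewrite length_app. specialize (Hlen (S j)). lia. }
  exists x. assert (Hsx : extends s x) by exact (extends_app _ _ _ (Hx 0)).
  split; auto. apply HS; auto. intro k. apply (proj2 (Hext (k, L k))). exact (Hx (S k)).
Qed.

Lemma comeager_sub s l A : comeager s A -> comeager (s ++ l) A.
Proof.
  intros (O & Ho & Hd & HS). exists O. split; [|split]; auto.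
  - intros k l'. rewrite <- app_assoc. apply Hd.
  - intros x Hx. apply HS. eapply extends_app; eauto.
Qed.

Lemma comeager_mono s (A T : _ -> Prop) :
  (forall x, extends s x -> A x -> T x) -> comeager s A -> comeager s T.
Proof. intros H (O & Ho & Hd & HS). exists O. split; [|split]; auto. Qed.

Lemma comeager_cinter s (A : nat -> (nat -> bool) -> Prop) :
  (forall n, comeager s (A n)) -> comeager s (fun x => forall n, A n x).
Proof.
  intro H. apply choice in H as [O HO].
  exists (fun z => let (n, k) := Cantor.of_nat z in O n k). split; [|split].
  - intro z. destruct (Cantor.of_nat z). apply HO.
  - intros z l. destruct (Cantor.of_nat z). apply HO.
  - intros x Hx K n. apply HO; auto. intro k.
    specialize (K (Cantor.to_nat (n, k))). now rewrite Cantor.cancel_of_to in K.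
Qed.

Lemma comeager_and s (A T : (nat -> bool) -> Prop) :
  comeager s A -> comeager s T -> comeager s (fun x => A x /\ T x).
Proof.
  intros HS HT.
  apply comeager_mono with (fun x => forall n : nat, (match n with 0 => A | _ => T end) x).
  - intros x _ H. split; [apply (H 0)|apply (H 1)].
  - apply comeager_cinter. intros [|]; auto.
Qed.

(** The index is one less than the number whose binary digits are 1 followed by [w]. *)
Lemma psi_surjective w : exists n, psi n = w.
Proof.
  assert (H : exists N, 0 < N /\ Nat.log2 N = length w /\
    forall i, i < length w -> Nat.testbit N (length w - 1 - i) = nth i w false).
  { induction w as [|b w IH] using rev_ind.
    - exists 1. split; [lia|split; [reflexivity|cbn; lia]].
    - destruct IH as (N & HN & Hlog & Hbit). exists (2 * N + Nat.b2n b).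
      rewrite length_app; cbn [length]. split; [lia|split].
      + replace (length w + 1) with (S (Nat.log2 N)) by lia.
        destruct b; cbn [Nat.b2n];
          [apply Nat.log2_succ_double|rewrite Nat.add_0_r; apply Nat.log2_double]; auto.
      + intros i Hi. destruct (Nat.eq_dec i (length w)) as [->|].
        * replace (length w + 1 - 1 - length w) with 0 by lia.
          rewrite app_nth2, Nat.sub_diag by lia. cbn [nth].
          destruct b; cbn [Nat.b2n]; [apply Nat.testbit_odd_0|].
          rewrite Nat.add_0_r. apply Nat.testbit_even_0.
        * rewrite app_nth1 by lia. rewrite <- Hbit by lia.
          replace (length w + 1 - 1 - i) with (S (length w - 1 - i)) by lia.
          destruct b; cbn [Nat.b2n]; [apply Nat.testbit_odd_succ; lia|].
          rewrite Nat.add_0_r. apply Nat.testbit_even_succ; lia. }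
  destruct H as (N & HN & Hlog & Hbit). exists (N - 1).
  unfold psi. replace (S (N - 1)) with N by lia. rewrite Hlog.
  apply nth_ext with (Nat.testbit N (length w - 1 - 0)) false; rewrite length_map, length_seq; auto.
  intros k Hk. rewrite (map_nth (fun i => Nat.testbit N (length w - 1 - i))), seq_nth by auto.
  now apply Hbit.
Qed.

(** The basic sets in which [A] is comeager have a union dense in that of [s], and there are
    countably many of them. The dense open sets witnessing each one are enlarged by the complement
    of that basic set, which is open as well. *)
Lemma comeager_locally s A : (forall l, exists l', comeager (s ++ l ++ l') A) -> comeager s A.
Proof.
  intros H.
  assert (K : forall w, exists O : nat -> (nat -> bool) -> Prop, comeager w A ->
    (forall k, cantor_open (O k)) /\ (forall k l, exists x, extends (w ++ l) x /\ O k x) /\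
    forall x, extends w x -> (forall k, O k x) -> A x).
  { intro w. destruct (classic (comeager w A)) as [[O HO]|Hw]; [now exists O|].
    exists (fun _ _ => True). tauto. }
  apply choice in K as [O HO].
  assert (Hopen : forall w, cantor_open (fun x => extends w x)).
  { intros w x Hx. exists (length w). intros y Hy. eapply extends_agree; eauto. }
  assert (Hclosed : forall w, cantor_open (fun x => ~ extends w x)).
  { intros w x Hx. exists (length w). intros y Hy Hyw. apply Hx.
    apply extends_agree with y (length w); auto. now apply agree_sym. }
  exists (fun z => match z with
    | 0 => fun x => exists w, comeager w A /\ extends w x
    | S z => let (n, k) := Cantor.of_nat z in
        fun x => comeager (psi n) A -> extends (psi n) x -> O (psi n) k x end).
  split; [|split].
  - intros [|z]; [|destruct (Cantor.of_nat z) as [n k]].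
    + intros x (w & Hw & Hx). destruct (Hopen w x Hx) as [m Hm]. exists m; eauto.
    + intros x Hx. destruct (classic (comeager (psi n) A)) as [Hw|Hw].
      2: exists 0; tauto.
      destruct (classic (extends (psi n) x)) as [Hxw|Hxw].
      * destruct (HO _ Hw) as [Ho _]. destruct (Ho k x (Hx Hw Hxw)) as [m Hm]. exists m; auto.
      * destruct (Hclosed _ x Hxw) as [m Hm]. exists m. intros y Hy _ Hyw. destruct (Hm y Hy Hyw).
  - intros [|z] l; [|destruct (Cantor.of_nat z) as [n k]].
    + destruct (H l) as [l' Hl']. destruct (extends_point (s ++ l ++ l')) as [x Hx].
      exists x. split; eauto. rewrite app_assoc in Hx. eapply extends_app; eauto.
    (* Padding makes [u] at least as long as [w], so that [u] either extends [w] or is incompatible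
       with it. *)
    + set (w := psi n). set (u := s ++ l ++ repeat false (length w)).
      destruct (classic (comeager w A /\ exists r, u = w ++ r)) as [[Hw [r Hr]]|Hno].
      * destruct (HO w Hw) as (_ & Hd & _). destruct (Hd k r) as (x & Hx & Ox).
        exists x; split; auto. rewrite <- Hr in Hx. unfold u in Hx. rewrite app_assoc in Hx.
        eapply extends_app; eauto.
      * destruct (extends_point u) as [x Hx]. exists x. split.
        { unfold u in Hx. rewrite app_assoc in Hx. eapply extends_app; eauto. }
        intros Hw Hxw. destruct Hno. split; auto.
        destruct (prefix_extends w (length u) x Hxw) as [r Hr].
        { unfold u. rewrite !length_app, repeat_length. lia. }
        exists r. rewrite <- Hr. apply nth_ext with false false; [now rewrite prefix_length|].
        intros j Hj. rewrite <- (Hx j Hj).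
        symmetry. rewrite <- (prefix_length (length u) x) in Hj.
        symmetry. apply (proj2 (extends_prefix (length u) x x)); auto. intros i Hi; auto.
  - intros x Hx Hall. destruct (Hall 0) as (w & Hw & Hxw). destruct (psi_surjective w) as [n <-].
    destruct (HO _ Hw) as (_ & _ & HS). apply HS; auto. intro k.
    specialize (Hall (S (Cantor.to_nat (n, k)))). cbn -[Cantor.of_nat Cantor.to_nat] in Hall.
    rewrite Cantor.cancel_of_to in Hall. auto.
Qed.

(** A localized Baire property, suited to the induction. For a union: if no [F n] is comeager in a
    basic subset, each complement is comeager in densely many of them, hence comeager by
    [comeager_locally]. *)
Lemma borel_baire_property A : borel Cantor A ->
  forall s, exists l, comeager (s ++ l) A \/ comeager (s ++ l) (fun x => ~ A x).
Proof.
  assert (Hall : forall s (T : (nat -> bool) -> Prop), (forall x, extends s x -> T x) -> comeager s T).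
  { intros s T H. exists (fun _ _ => True). split; [|split]; auto.
    - intros k x _. exists 0; auto.
    - intros k l. destruct (extends_point (s ++ l)) as [x Hx]. eauto. }
  induction 1 as [U HU|U HU IH|F HF IH]; intro s.
  - destruct (classic (exists x, extends s x /\ U x)) as [(x & Hx & Ux)|Hno].
    + destruct (cantor_open_basic U s x HU Hx Ux) as (l & _ & Hl). exists l. left. now apply Hall.
    + exists []. right. apply Hall. rewrite app_nil_r. intros x Hx Ux. eauto.
  - destruct (IH s) as (l & [H|H]); exists l; [right|left; auto].
    revert H. apply comeager_mono. tauto.
  - destruct (classic (exists n l, comeager (s ++ l) (F n))) as [(n & l & H)|Hno].
    + exists l. left. revert H. apply comeager_mono. eauto.
    + exists []. right. rewrite app_nil_r.
      apply comeager_mono with (fun x => forall n, ~ F n x).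
      * intros x _ H [n Hn]. exact (H n Hn).
      * apply comeager_cinter. intro n. apply comeager_locally. intro l.
        destruct (IH n (s ++ l)) as (l' & [H|H]); exists l'; rewrite app_assoc; auto.
        destruct Hno. exists n, (l ++ l'). now rewrite app_assoc.
Qed.

Section Chromatic.
Variables (t : nat -> list bool) (f : nat -> (nat -> bool) -> nat -> bool).
Hypothesis t_dense : forall s, exists n l, t n = s ++ l.
Hypothesis f_below : forall n x k, k < length (t n) -> f n x k = x k.
Hypothesis f_continuous : forall n x k, exists N, forall y, agree N y x -> f n y k = f n x k.
Hypothesis f_open : forall n r, exists w, forall z, extends (t n ++ w) z ->
  exists x, extends ((t n ++ [false]) ++ r) x /\ f n x = z.

(** Some colour class is comeager in the basic set of some [s], and some [t n] extends [s]. By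
    [f_open], preimages under [f n] of dense open sets are dense in the domain of [f n], so a
    generic [x] there has the colour of its image. *)
Theorem graph_of_uncountable_chromatic : ~ countable_borel_chromatic Cantor (graph_of t f).
Proof.
  intros (c & Hc & Hcol).
  assert (Hcn : forall n, borel Cantor (fun x => c x = n)).
  { intro n. exact (Hc (fun m => m = n) I). }
  assert (Hn : exists s n, comeager s (fun x => c x = n)).
  { apply NNPP; intro Hno.
    destruct (baire_category [] (fun x => forall n, c x <> n)) as (x & _ & Hx).
    - apply comeager_cinter. intro n. apply comeager_locally. intro l.
      destruct (borel_baire_property _ (Hcn n) l) as (l' & [H|H]); [|now exists l'].
      destruct Hno; eauto.
    - exact (Hx _ eq_refl). }
  destruct Hn as (s & m & Hm). destruct (t_dense s) as (n & l & Htn).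
  destruct (baire_category (t n ++ [false]) (fun x => c x = m /\ c (f n x) = m)) as (x & Hx & E1 & E2).
  - apply comeager_and.
    + rewrite Htn, <- app_assoc. now apply comeager_sub.
    + destruct Hm as (O & Ho & Hd & HS). exists (fun k x => O k (f n x)). split; [|split].
      * intros k x Ox. destruct (Ho k _ Ox) as [N HN].
        destruct (finite_bound (fun j M => forall y, agree M y x -> f n y j = f n x j) N) as [M HM].
        { intros j M M' Hle H y Hy. apply H. eapply agree_le; eauto. }
        { intros j _. apply f_continuous. }
        exists M. intros y Hy. apply HN. intros j Hj. now apply HM.
      * intros k r. destruct (f_open n r) as [w Hw].
        destruct (Hd k (l ++ w)) as (z & Hz & Oz). rewrite app_assoc, <- Htn in Hz.
        destruct (Hw z Hz) as (x & Hx & <-). eauto.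
      * intros x Hx. apply HS. apply extends_app with l. rewrite <- Htn.
        apply extends_app in Hx. intros k Hk. rewrite f_below by auto. now apply Hx.
  - apply (Hcol x (f n x)); [|congruence]. exists n; auto.
Qed.
End Chromatic.

Lemma G0_uncountable_chromatic : ~ countable_borel_chromatic Cantor G0.
Proof.
  intros (c & Hc & Hcol).
  apply (graph_of_uncountable_chromatic s_seq flip).
  - intro s. destruct (psi_surjective s) as [n <-]. exists n. unfold s_seq. eauto.
  - intros n x k Hk. rewrite s_seq_length in Hk. unfold flip. destruct (Nat.eqb_spec k n); [lia|auto].
  - apply flip_continuous.
  - intros n r. exists ([true] ++ r). intros z Hz.
    exists (fun k => if k =? n then false else z k). split.
    + intros k Hk. unfold extends in Hz. rewrite <- app_assoc in *.
      rewrite !length_app in *. cbn [length app] in *. specialize (Hz k Hk). rewrite s_seq_length in *.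
      destruct (Nat.eqb_spec k n) as [->|].
      * rewrite app_nth2, s_seq_length, Nat.sub_diag by (rewrite s_seq_length; lia). reflexivity.
      * rewrite Hz. destruct (le_lt_dec n k).
        -- rewrite !app_nth2 by (rewrite s_seq_length; lia). rewrite s_seq_length.
           destruct (k - n) eqn:E; [lia|reflexivity].
        -- now rewrite !app_nth1 by (rewrite s_seq_length; lia).
    + extensionality k. unfold flip. destruct (Nat.eqb_spec k n) as [->|]; auto.
      rewrite (Hz n).
      * rewrite app_nth2, s_seq_length, Nat.sub_diag by (rewrite s_seq_length; lia). reflexivity.
      * rewrite length_app, s_seq_length; cbn; lia.
  - exists c. split; auto. intros x y Hxy. apply Hcol. now apply G0_graph.
Qed.

Lemma G1_uncountable_chromatic : ~ countable_borel_chromatic Cantor G1.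
Proof.
  apply (graph_of_uncountable_chromatic t_seq g_map).
  - intro s. destruct (psi_surjective s) as [n <-]. exists n. unfold t_seq. eauto.
  - apply g_map_below.
  - apply g_map_continuous.
  - intros n r. set (p := 2 ^ q n). set (u := (t_seq n ++ [false]) ++ r).
    assert (Hp : p <> 0) by now apply Nat.pow_nonzero.
    assert (Hu : p < length u).
    { unfold u. rewrite !length_app, t_seq_length. cbn. fold p. lia. }
    assert (Hu' : forall k, k < p -> nth k u false = nth k (t_seq n) false).
    { intros k Hk. unfold u. rewrite <- app_assoc, app_nth1; auto. now rewrite t_seq_length. }
    (* The image under [g_map n] of [u] padded with false; a point agreeing with it below the length
       of [u] has a preimage extending [u]. *)
    pose (z0 := fun k => if k =? p then true else nth (theta n k) u false).
    exists (map z0 (seq p (length u - p))). intros z Hz.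
    assert (Hz1 : forall k, k < p -> z k = nth k u false).
    { intros k Hk. rewrite Hu' by auto. apply extends_app in Hz. apply Hz. now rewrite t_seq_length. }
    assert (Hz2 : forall k, p <= k -> k < length u -> z k = z0 k).
    { intros k Hk Hku. rewrite Hz.
      - rewrite app_nth2 by (rewrite t_seq_length; auto). rewrite t_seq_length. fold p.
        rewrite nth_indep with (d' := z0 0) by (rewrite length_map, length_seq; lia).
        rewrite map_nth, seq_nth by lia. f_equal; lia.
      - rewrite length_app, length_map, length_seq, t_seq_length. fold p. lia. }
    (* a left inverse of [theta n] off [p] *)
    pose (rho := fun k => if k mod p =? 0 then (k - p) / 2 else k).
    assert (Hrho : forall k, 0 < k -> rho (theta n k) = k /\ k <= theta n k).
    { intros k Hk. unfold rho. destruct (Nat.eq_dec (k mod p) 0) as [E|E].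
      - rewrite theta_multiple by auto. fold p.
        rewrite Nat.mul_comm, Nat.Div0.mod_mul. cbn [Nat.eqb].
        pose proof (Nat.Div0.div_exact k p) as K. apply K in E.
        replace ((2 * (k / p) + 1) * p - p) with (k * 2) by lia. rewrite Nat.div_mul by lia. lia.
      - rewrite theta_fixed by (fold p; tauto). apply Nat.eqb_neq in E. rewrite E. lia. }
    exists (fun k => if k <? length u then nth k u false else z (rho k)). split.
    + intros k Hk. apply Nat.ltb_lt in Hk. fold u in Hk. now rewrite Hk.
    + extensionality k. unfold g_map. fold p. destruct (Nat.eqb_spec k p) as [->|Hkp].
      * rewrite Hz2 by auto. unfold z0. now rewrite Nat.eqb_refl.
      * destruct (le_lt_dec p k) as [h|h].
        -- destruct (Hrho k) as [H1 H2]; [lia|].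
           destruct (Nat.ltb_spec (theta n k) (length u)) as [h'|h']; [|now rewrite H1].
           rewrite Hz2 by lia. unfold z0. apply Nat.eqb_neq in Hkp. now rewrite Hkp.
        -- rewrite theta_fixed by (fold p; rewrite Nat.mod_small; lia).
           destruct (Nat.ltb_spec k (length u)); [|lia]. symmetry. now apply Hz1.
Qed.

(** * Degrees and the antichain *)

Section CantorMetric.
Local Open Scope R_scope.

Definition first_diff (x y : nat -> bool) : nat :=
  epsilon (inhabits O) (fun n => x n <> y n /\ agree n x y).

Lemma first_diff_spec x y : x <> y -> x (first_diff x y) <> y (first_diff x y) /\ agree (first_diff x y) x y.
Proof.
  intro H. apply (epsilon_spec (inhabits O) (fun n => x n <> y n /\ agree n x y)).
  destruct (least_element (fun n => x n <> y n)) as (n & Hn & Hmin).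
  - apply NNPP; intro Hno. apply H. extensionality n. apply NNPP; eauto.
  - exists n; split; auto. intros k Hk. apply NNPP. intro K; exact (Hmin k Hk K).
Qed.

Definition cdist (x y : nat -> bool) : R :=
  if excluded_middle_informative (x = y) then 0 else (1/2) ^ first_diff x y.

Lemma cdist_agree x y n : cdist x y < (1/2)^n -> agree n x y.
Proof.
  unfold cdist. destruct (excluded_middle_informative (x = y)) as [->|H]; [intros _ k _; auto|].
  intros K k Hk. apply (first_diff_spec x y H). destruct (Nat.lt_ge_cases k (first_diff x y)); auto.
  pose proof (half_pow_le (first_diff x y) n). assert (first_diff x y <= n)%nat by lia.
  apply H1 in H2. lra.
Qed.

Lemma agree_cdist x y n : agree n x y -> cdist x y <= (1/2)^n.
Proof.
  intro H. unfold cdist. pose proof (half_pow_pos n).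
  destruct (excluded_middle_informative (x = y)) as [_|Hne]; [lra|].
  apply half_pow_le. destruct (first_diff_spec x y Hne) as [K _].
  destruct (Nat.lt_ge_cases (first_diff x y) n) as [h|h]; [destruct K; auto|auto].
Qed.

Lemma cdist_nonneg x y : 0 <= cdist x y.
Proof.
  unfold cdist. destruct (excluded_middle_informative _); [lra|].
  pose proof (half_pow_pos (first_diff x y)); lra.
Qed.

Lemma cdist_eq0 x y : cdist x y = 0 <-> x = y.
Proof.
  unfold cdist. destruct (excluded_middle_informative (x = y)) as [E|E]; [tauto|].
  pose proof (half_pow_pos (first_diff x y)). split; [lra|contradiction].
Qed.

Lemma cdist_cases x y : x = y \/ exists n, cdist x y = (1/2)^n /\ agree n x y.
Proof.
  unfold cdist. destruct (excluded_middle_informative (x = y)) as [E|E]; auto.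
  right. exists (first_diff x y). split; auto. now apply first_diff_spec.
Qed.

Lemma cdist_refl x : cdist x x = 0.
Proof. now apply cdist_eq0. Qed.

Lemma cdist_sym x y : cdist x y = cdist y x.
Proof.
  assert (H : forall x y, cdist x y <= cdist y x).
  { clear. intros x y. destruct (cdist_cases y x) as [->|(n & -> & Ha)]; [rewrite cdist_refl; lra|].
    apply agree_cdist. now apply agree_sym. }
  apply Rle_antisym; apply H.
Qed.

Lemma cdist_tri x y z : cdist x z <= cdist x y + cdist y z.
Proof.
  pose proof (cdist_nonneg x y). pose proof (cdist_nonneg y z).
  destruct (cdist_cases x y) as [->|(n & E & Hn)]; [lra|].
  destruct (cdist_cases y z) as [->|(m & E' & Hm)]; [lra|].
  destruct (Nat.le_ge_cases n m) as [h|h].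
  - assert (cdist x z <= (1/2)^n); [|lra]. apply agree_cdist.
    apply agree_trans with y; auto. now apply (agree_le n m).
  - assert (cdist x z <= (1/2)^m); [|lra]. apply agree_cdist.
    apply agree_trans with y; auto. now apply (agree_le m n).
Qed.

Lemma cdist_complete (u : nat -> nat -> bool) :
  (forall eps, 0 < eps -> exists N, forall m n, (N <= m)%nat -> (N <= n)%nat -> cdist (u m) (u n) < eps) ->
  exists l, forall eps, 0 < eps -> exists N, forall n, (N <= n)%nat -> cdist (u n) l < eps.
Proof.
  intro H.
  assert (K : forall k, exists N, forall m n, (N <= m)%nat -> (N <= n)%nat -> agree k (u m) (u n)).
  { intro k. destruct (H _ (half_pow_pos k)) as [N HN]. exists N. intros; apply cdist_agree; auto. }
  apply choice in K as [N HN]. exists (fun j => u (N (S j)) j). intros eps He.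
  destruct (half_pow_small eps He) as [k Hk].
  destruct (finite_bound (fun j M => (N (S j) <= M)%nat) k) as [M HM]; [intros; lia|eauto|].
  exists M. intros n Hn. apply Rle_lt_trans with ((1/2)^k); auto. apply agree_cdist.
  intros j Hj. specialize (HM j Hj). apply (HN (S j)); lia.
Qed.

Lemma cdist_separable : exists s : nat -> option (nat -> bool),
  forall x eps, 0 < eps -> exists n y, s n = Some y /\ cdist x y < eps.
Proof.
  exists (fun n => Some (fun k => nth k (psi n) false)). intros x eps He.
  destruct (half_pow_small eps He) as [k Hk]. destruct (psi_surjective (prefix k x)) as [n Hn].
  exists n, (fun k => nth k (psi n) false). split; auto.
  apply Rle_lt_trans with ((1/2)^k); auto. apply agree_cdist. rewrite Hn.
  apply agree_sym, extends_prefix. intros j _; auto.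
Qed.

(** [Cantor] is a bare topology, whereas minimality quantifies over [Polish] structures; this one
    lets a digraph on Cantor space be a competitor. *)
Definition CantorPolish : Polish :=
  {| P_dist_nonneg := cdist_nonneg; P_dist_eq0 := cdist_eq0; P_dist_sym := cdist_sym;
     P_dist_tri := cdist_tri; P_complete := cdist_complete; P_separable := cdist_separable |}.

Lemma cantor_metric_open : cantor_open = metric_open CantorPolish.
Proof.
  extensionality U. apply propositional_extensionality. split; intros HU x Ux.
  - destruct (HU x Ux) as [n Hn]. exists ((1/2)^n). split; [apply half_pow_pos|].
    intros y Hy. apply Hn. apply agree_sym. now apply cdist_agree.
  - destruct (HU x Ux) as (eps & He & HUe). destruct (half_pow_small eps He) as [n Hn].
    exists n. intros y Hy. apply HUe. apply Rle_lt_trans with ((1/2)^n); auto.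
    apply agree_cdist. now apply agree_sym.
Qed.
End CantorMetric.

Lemma swap_continuous (X : TopSp) : continuous (prodT X X) (prodT X X) (fun p => (snd p, fst p)).
Proof.
  intros V HV [x y] Vp. destruct (HV _ Vp) as (U & W & HU & HW & Uy & Wx & H).
  exists W, U. cbn in *. auto 6.
Qed.

Lemma analytic_rel_inv (X : TopSp) A : analytic_rel X A -> analytic_rel X (inv_rel A).
Proof.
  intro H. apply (analytic_image _ _ _ _ (swap_continuous X)) in H. revert H.
  apply analytic_ext. intros [x y]. unfold inv_rel; cbn. split.
  - intros ([a b] & Hab & E). cbn in *. congruence.
  - intros Hyx. now exists (y, x).
Qed.

Lemma countable_chromatic_inv (X : TopSp) A :
  countable_borel_chromatic X (inv_rel A) -> countable_borel_chromatic X A.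
Proof.
  intros (c & Hc & H). exists c; split; auto. intros x y Hxy E. now apply (H y x).
Qed.

Lemma graph_of_analytic t f :
  (forall n x k, exists N, forall y, agree N y x -> f n y k = f n x k) ->
  analytic_rel Cantor (graph_of t f).
Proof.
  intro Hf. right.
  (* The first entries are overwritten by [t n ++ [false]], so every parameter decodes to a point of
     the domain. *)
  pose (dec := fun n (a : nat -> nat) k => if k <? length (t n ++ [false])
    then nth k (t n ++ [false]) false else Nat.odd (a k)).
  exists (fun c => (dec (c 0) (tail c), f (c 0) (dec (c 0) (tail c)))). split.
  - apply (branch_continuous (prodT Cantor Cantor) (fun n a => (dec n a, f n (dec n a)))). intro n.
    assert (Hd : forall a k b, agree (S k) b a -> dec n b k = dec n a k).
    { intros a k b Hb. unfold dec. now rewrite Hb by lia. }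
    apply (pair_continuous Cantor Cantor); apply cantor_continuous; intros a k.
    + exists (S k). auto.
    + destruct (Hf n (dec n a) k) as [N HN]. exists N. intros b Hb. apply HN.
      intros j Hj. apply Hd. apply (agree_le _ N); auto.
  - intros [x y]. cbn [fst snd]. split.
    + intros (n & Hx & Hy). exists (ncons n (fun k => Nat.b2n (x k))).
      rewrite tail_ncons. cbn [ncons].
      assert (E : dec n (fun k => Nat.b2n (x k)) = x).
      { extensionality k. unfold dec. destruct (Nat.ltb_spec k (length (t n ++ [false]))).
        - symmetry; auto.
        - now destruct (x k). }
      rewrite E. apply (f_equal (pair x)). extensionality k; auto.
    + intros [c E]. injection E as <- <-. exists (c 0). split; auto.
      intros k Hk. unfold dec. apply Nat.ltb_lt in Hk. now rewrite Hk.
Qed.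

(** Degrees are compared through injectivity alone, so forgetting regularity excludes continuous and
    Borel reductions together. *)
Definition inj_hom (A B : (nat -> bool) -> (nat -> bool) -> Prop) : Prop :=
  exists h, injective h /\ forall x y, A x y -> B (h x) (h y).

Definition in_degree_uncountable (A : (nat -> bool) -> (nat -> bool) -> Prop) : Prop :=
  exists e y, injective e /\ forall z : nat -> bool, A (e z) y.

Definition in_degrees_countable (A : (nat -> bool) -> (nat -> bool) -> Prop) : Prop :=
  forall y, exists e : nat -> nat -> bool, forall x, A x y -> exists n, x = e n.

Lemma no_inj_hom A B : in_degree_uncountable A -> in_degrees_countable B -> ~ inj_hom A B.
Proof.
  intros (e & y & He & HA) HB (h & Hh & Hhom).
  destruct (HB (h y)) as [s Hs].
  assert (K : forall z, exists n, h (e z) = s n) by (intro z; apply Hs, Hhom, HA).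
  apply choice in K as [c Hc].
  assert (Hinj : injective c).
  { intros z z' E. apply He, Hh. now rewrite !Hc, E. }
  (* [epsilon] inverts the injection [c] into the integers, and [diag] differs at [n] from the point
     chosen over [n]. *)
  pose (diag := fun n => negb (epsilon (inhabits (fun _ => false)) (fun z => c z = n) n)).
  pose proof (epsilon_spec (inhabits (fun _ => false)) (fun z => c z = c diag) (ex_intro _ diag eq_refl)) as E.
  cbn in E. apply Hinj in E. apply (f_equal (fun z => z (c diag))) in E.
  unfold diag at 3 in E. destruct (epsilon _ _ _); discriminate.
Qed.

Lemma graph_of_out_countable t f : in_degrees_countable (inv_rel (graph_of t f)).
Proof.
  intro y. exists (fun n => f n y). intros x (n & _ & E). exists n. now extensionality k.
Qed.

Lemma G0_inv_countable : in_degrees_countable (inv_rel G0).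
Proof.
  intro y. destruct (graph_of_out_countable s_seq flip y) as [e He].
  exists e. intros x H. apply He. now apply G0_graph.
Qed.

Lemma G0_countable : in_degrees_countable G0.
Proof.
  intro y. exists (fun n k => if k =? n then false else y k). intros x H.
  apply G0_graph in H as (n & Hx & E). exists n. extensionality k. rewrite E. unfold flip.
  apply extends_snoc in Hx as [_ Hx]. rewrite s_seq_length in Hx.
  destruct (Nat.eqb_spec k n) as [->|]; auto.
Qed.

(* [g_map 0] forgets the positive even coordinates. *)
Lemma G1_uncountable : in_degree_uncountable G1.
Proof.
  exists (fun z k => if k <? 2 then false else if Nat.even k then z (k / 2 - 1) else false).
  exists (fun k => k =? 1). split.
  - intros z z' E. extensionality k. apply (f_equal (fun x => x (2 * (k + 1)))) in E.
    rewrite Nat.even_even, (Nat.mul_comm 2 (k + 1)), Nat.div_mul, Nat.add_sub in E by lia.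
    destruct (Nat.ltb_spec ((k + 1) * 2) 2); [lia|auto].
  - intro z. exists 0. split.
    + intros k Hk. change (k < 2) in Hk. destruct k as [|[|]]; [reflexivity|reflexivity|lia].
    + intro k. unfold g_map. cbn [q Nat.pow]. destruct (Nat.eqb_spec k 1) as [|Hk]; auto.
      destruct k as [|k]; [reflexivity|]. unfold theta. cbn [q Nat.pow].
      rewrite Nat.mod_1_r, Nat.div_1_r. change (0 <? S k) with true. cbn [Nat.eqb andb].
      rewrite Nat.mul_1_l, Nat.even_odd. now destruct (_ <? 2).
Qed.

Lemma red_le_inj_hom C o o' A B :
  red_le C {| pt := nat -> bool; opn := o |} A {| pt := nat -> bool; opn := o' |} B -> inj_hom A B.
Proof. intros (h & H1 & _ & H2). exists h; auto. Qed.

Lemma inj_hom_inv A B : inj_hom A B -> inj_hom (inv_rel A) (inv_rel B).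
Proof. intros (h & H1 & H2). exists h; split; auto. intros x y; apply H2. Qed.

Lemma minimal_reverse C A B : minimal_uncountable C Cantor A -> minimal_uncountable C Cantor B ->
  red_le C Cantor B Cantor A -> inj_hom A B.
Proof.
  intros (_ & _ & _ & Hmin) (HB & HBa & HBc & _) Hred.
  assert (E := cantor_metric_open).
  apply (red_le_inj_hom C cantor_open (metric_open CantorPolish)).
  refine (Hmin CantorPolish B HB _ _ _).
  - exact (eq_ind _ (fun o => analytic_rel {| pt := nat -> bool; opn := o |} B) HBa _ E).
  - exact (eq_ind _ (fun o => ~ countable_borel_chromatic {| pt := nat -> bool; opn := o |} B) HBc _ E).
  - exact (eq_ind _ (fun o => red_le C {| pt := nat -> bool; opn := o |} B Cantor A) Hred _ E).
Qed.

Lemma good_map_borel C (X Z : TopSp) h : good_map C X Z h -> borel_fun X Z h.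
Proof. destruct C; [apply continuous_borel_fun|auto]. Qed.

(** The fusion yields a continuous map even from a Borel reduction; here it is weakened to the class
    at hand. *)
Lemma red_le_of_continuous C (X Z : TopSp) A B : red_le RC X A Z B -> red_le C X A Z B.
Proof.
  intros (h & H1 & H2 & H3). exists h; split; [|split]; auto.
  destruct C; [exact H2|now apply continuous_borel_fun].
Qed.

Lemma red_le_inv C (X Z : TopSp) A B : red_le C X A Z B -> red_le C X (inv_rel A) Z (inv_rel B).
Proof. intros (h & H1 & H2 & H3). exists h; split; [|split]; auto. intros x y; apply H3. Qed.

Lemma G0_minimal C : minimal_uncountable C Cantor G0.
Proof.
  split; [|split; [|split]].
  - intros x H. apply G0_graph in H. revert H. apply graph_of_irrefl.
    intros n y _; apply flip_flip.
  - apply analytic_ext with (2 := graph_of_analytic s_seq flip flip_continuous).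
    intros [x y]; cbn; symmetry; apply G0_graph.
  - apply G0_uncountable_chromatic.
  - intros Y B _ HBa HBc (h & H1 & H2 & H3). apply red_le_of_continuous.
    apply (G0_embeds Y B h); auto. now apply good_map_borel in H2.
Qed.

Lemma G1_minimal C : minimal_uncountable C Cantor G1.
Proof.
  split; [|split; [|split]].
  - intros x. apply (graph_of_irrefl t_seq g_map). intros n y _; apply g_map_flip.
  - apply (graph_of_analytic t_seq g_map g_map_continuous).
  - apply G1_uncountable_chromatic.
  - intros Y B _ HBa HBc (h & H1 & H2 & H3). apply red_le_of_continuous.
    apply (G1_embeds Y B h); auto. now apply good_map_borel in H2.
Qed.

(** Inversion preserves all notions involved, so a competitor [B] is handled through its inverse. *)
Lemma minimal_inv C A : minimal_uncountable C Cantor A -> minimal_uncountable C Cantor (inv_rel A).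
Proof.
  intros (H1 & H2 & H3 & H4). split; [|split; [|split]].
  - exact H1.
  - now apply analytic_rel_inv.
  - intro H; apply H3. now apply countable_chromatic_inv.
  - intros Y B HB HBa HBc Hred. apply (red_le_inv C Cantor Y A (inv_rel B)).
    apply H4; auto.
    + now apply analytic_rel_inv.
    + intro H; apply HBc. now apply countable_chromatic_inv.
    + now apply (red_le_inv C Y Cantor B (inv_rel A)).
Qed.

Theorem theorem1p3 : forall C : redclass,
  (~ red_le C Cantor G0 Cantor G1 /\ ~ red_le C Cantor G1 Cantor G0 /\
   ~ red_le C Cantor G0 Cantor (inv_rel G1) /\ ~ red_le C Cantor (inv_rel G1) Cantor G0 /\
   ~ red_le C Cantor G1 Cantor (inv_rel G1) /\ ~ red_le C Cantor (inv_rel G1) Cantor G1) /\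
  minimal_uncountable C Cantor G0 /\
  minimal_uncountable C Cantor G1 /\
  minimal_uncountable C Cantor (inv_rel G1).
Proof.
  intro C. pose proof (G0_minimal C) as M0. pose proof (G1_minimal C) as M1.
  pose proof (minimal_inv C G1 M1) as M2.
  assert (H1 : ~ inj_hom G1 G0) by exact (no_inj_hom _ _ G1_uncountable G0_countable).
  assert (H2 : ~ inj_hom (inv_rel G1) G0).
  { intro H. apply inj_hom_inv in H. exact (no_inj_hom _ _ G1_uncountable G0_inv_countable H). }
  assert (H3 : ~ inj_hom G1 (inv_rel G1)).
  { exact (no_inj_hom _ _ G1_uncountable (graph_of_out_countable t_seq g_map)). }
  split; [|auto]. repeat split; intro H.
  - apply H1. now apply (minimal_reverse C).
  - apply H1. exact (red_le_inj_hom _ _ _ _ _ H).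
  - apply H2. now apply (minimal_reverse C).
  - apply H2. exact (red_le_inj_hom _ _ _ _ _ H).
  - apply H3. exact (red_le_inj_hom _ _ _ _ _ H).
  - apply H3. apply red_le_inj_hom in H. now apply inj_hom_inv in H.
Qed.
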